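(* Let $I=I_\Delta\subset k[x_0,\dots,x_r]$ be an ideal generated by quadratic squarefree monomials, where $\Delta$ is the corresponding simplicial complex (under the Stanley–Reisner correspondence) with vertices $x_0,\dots,x_r$, and let $G$ be the $1$-skeleton of $\Delta$. For $p>1$, the ideal $I$ satisfies the condition $\mathbf{N}_{2,p}$ if and only if every minimal cycle in $G$ has length $\ge p+3$.
   Context: $k$ is an algebraically closed field and $S=k[x_0,\dots,x_r]$. For a simplicial complex $\Delta$ on the vertices $x_0,\dots,x_r$ (each $x_i$ is a vertex, so no variable lies in $I_\Delta$), the Stanley–Reisner ideal $I_\Delta$ is generated by the squarefree monomials $x_{i_1}\cdots x_{i_s}$ such that $\{x_{i_1},\dots,x_{i_s}\}$ is not a face of $\Delta$. A homogeneous ideal $I\subset S$ containing no nonzero forms of degree $\le 1$ satisfies $\mathbf{N}_{2,p}$ if $\operatorname{Tor}_i^S(I,k)$ is concentrated in degrees $\le i+2$ for all $0\le i\le p-1$ (i.e. $I$ is generated by quadrics and its minimal free resolution is linear for the first $p$ steps). A cycle of length $q\ge 3$ in a graph $G$ is a sequence of distinct edges $(v_1,v_2),(v_2,v_3),\dots,(v_q,v_1)$ joining distinct vertices $v_1,\dots,v_q$. It has a chord if $G$ has an edge joining two of the $v_i$ that are not consecutive in the cycle (cyclically). A cycle is minimal if $q>3$ and it has no chord. *)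

(* Defs.v *)
From mathcomp Require Import all_boot all_order all_algebra.
From mathcomp Require Import mpoly.

Set Implicit Arguments.
Unset Strict Implicit.
Unset Printing Implicit Defensive.

Import GRing.Theory Num.Theory.
Local Open Scope ring_scope.

(* Every vertex of 'I_n is a face, hence no variable lies in the
   Stanley-Reisner ideal. *)
Definition simplicial_complex (n : nat) (D : {set {set 'I_n}}) : Prop :=
  (forall A B : {set 'I_n}, A \subset B -> B \in D -> A \in D) /\
  (forall i : 'I_n, [set i] \in D).

Definition sqfree_monomial (k : fieldType) (n : nat) (A : {set 'I_n}) :
    {mpoly k[n]} :=
  \prod_(i in A) 'X_i.

Definition sqfree_ideal (k : fieldType) (n : nat) (E : {set {set 'I_n}})
    (f : {mpoly k[n]}) : Prop :=
  exists c : {set 'I_n} -> {mpoly k[n]},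
    f = \sum_(A in E) c A * sqfree_monomial k A.

Definition stanley_reisner (k : fieldType) (n : nat) (D : {set {set 'I_n}}) :
    {mpoly k[n]} -> Prop :=
  sqfree_ideal (k := k) (~: D).

Definition generated_by_sqfree_quadrics (k : fieldType) (n : nat)
    (I : {mpoly k[n]} -> Prop) : Prop :=
  exists2 E : {set {set 'I_n}},
    (forall A : {set 'I_n}, A \in E -> #|A| = 2%N) &
    (forall f : {mpoly k[n]}, I f <-> sqfree_ideal E f).

(* A resolution ... -> F_2 -> F_1 -> F_0 -> I -> 0 by finitely generated
   graded free modules over S = k[x_0, ..., x_{n-1}].  The module F_i is
   S(-a_1) (+) ... (+) S(-a_b) with b = gfr_rank i and a_j = gfr_deg i j;
   its elements are row vectors, on which the differential
   gfr_diff i : F_(i+1) -> F_i and the augmentation act by right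
   multiplication.  All maps are homogeneous of degree 0. *)
Record graded_free_resolution (k : fieldType) (n : nat)
    (I : {mpoly k[n]} -> Prop) := GradedFreeResolution {
  gfr_rank : nat -> nat;
  gfr_deg : forall i : nat, 'I_(gfr_rank i) -> int;
  gfr_aug : 'cV[{mpoly k[n]}]_(gfr_rank 0);
  gfr_diff : forall i : nat, 'M[{mpoly k[n]}]_(gfr_rank i.+1, gfr_rank i);
  gfr_aug_homog : forall (j : 'I_(gfr_rank 0)) (m : 'X_{1..n}),
    m \in msupp (gfr_aug j 0) -> gfr_deg j = (mdeg m)%:Z;
  gfr_diff_homog : forall (i : nat) (j : 'I_(gfr_rank i.+1))
      (l : 'I_(gfr_rank i)) (m : 'X_{1..n}),
    m \in msupp (gfr_diff i j l) -> gfr_deg j = gfr_deg l + (mdeg m)%:Z;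
  gfr_aug_image : forall f : {mpoly k[n]},
    I f <-> exists v : 'rV_(gfr_rank 0), v *m gfr_aug = f%:M;
  gfr_exact0 : forall v : 'rV_(gfr_rank 0),
    v *m gfr_aug = 0 <-> exists w : 'rV_(gfr_rank 1), v = w *m gfr_diff 0;
  gfr_exactS : forall (i : nat) (v : 'rV_(gfr_rank i.+1)),
    v *m gfr_diff i = 0 <->
    exists w : 'rV_(gfr_rank i.+2), v = w *m gfr_diff i.+1
}.

Section Tor.

Variables (k : fieldType) (n : nat) (I : {mpoly k[n]} -> Prop).
Variable F : graded_free_resolution I.

(* Since k = S/(x_0, ..., x_{n-1}), tensoring the complex F with k replaces
   each entry of a differential by its constant coefficient. *)
Definition gfr_tensor_diff (i : nat) :
    'M[k]_(gfr_rank F i.+1, gfr_rank F i) :=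
  map_mx (mcoeff 0%MM) (gfr_diff F i).

Definition gfr_tensor_cycle (i : nat) : 'rV[k]_(gfr_rank F i) -> Prop :=
  match i with
  | 0 => fun=> True
  | j.+1 => fun v => v *m gfr_tensor_diff j = 0
  end.

Definition gfr_tensor_homog (i : nat) (d : int)
    (v : 'rV[k]_(gfr_rank F i)) : Prop :=
  forall j : 'I_(gfr_rank F i), v 0 j != 0 -> gfr_deg j = d.

(* Tor_i^S(I, k)_d = H_i(F (x)_S k)_d = 0 *)
Definition tor_degree_vanishes (i : nat) (d : int) : Prop :=
  forall v : 'rV[k]_(gfr_rank F i),
    gfr_tensor_homog d v -> gfr_tensor_cycle v ->
    exists2 w : 'rV[k]_(gfr_rank F i.+1),
      gfr_tensor_homog d w & v = w *m gfr_tensor_diff i.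

End Tor.

(* Meant for homogeneous ideals I without nonzero forms of degree <= 1.
   Tor does not depend on the graded free resolution used to compute it, and
   every homogeneous ideal of S has one with all F_i finitely generated, so the
   quantifier over F could equivalently be universal. *)
Definition satisfies_N2 (k : fieldType) (n : nat) (I : {mpoly k[n]} -> Prop)
    (p : nat) : Prop :=
  exists F : graded_free_resolution I,
    forall (i : nat) (d : int), (i < p)%N -> (i.+2)%:Z < d ->
      tor_degree_vanishes F i d.

Definition one_skeleton (n : nat) (D : {set {set 'I_n}}) : rel 'I_n :=
  fun i j => (i != j) && ([set i; j] \in D).

Section Cycles.

Variables (T : finType) (e : rel T).

(* The edges of such a cycle are distinct because its length is at least 3
   and its vertices are distinct. *)
Definition graph_cycle (c : seq T) : Prop := (3 <= size c)%N /\ ucycle e c.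

Definition has_chord (c : seq T) : Prop :=
  exists x y : T,
    [/\ x \in c, y \in c, e x y, y != next c x & x != next c y].

Definition minimal_cycle (c : seq T) : Prop :=
  [/\ graph_cycle c, (3 < size c)%N & ~ has_chord c].

End Cycles.

(* Main.v *)
(* Tor is computed from an explicit finite free resolution of I_Delta, with basis
   e_A m_B for disjoint sets A, B of vertices, B not a face, sitting in
   homological degree |A| and sent by the augmentation to x^B when A is empty.
   Dividing by one variable at a time gives a homotopy that pushes every cycle
   into A = empty, hence exactness.  Modulo the variables only the terms
   e_A m_B |-> e_(A-a) m_(B+a) survive, so in multidegree W one finds the
   simplicial cochains of the full simplex on W relative to Delta_W (Hochster's
   formula); chain maps carry the vanishing of Tor over from any other
   resolution.

   For t >= 2, every cocycle of Delta_W on faces with t vertices is a coboundary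
   as soon as |W| <= p + t and minimal cycles have length >= p + 3: remove a
   vertex v and pass to the link of v, lowering t, until t = 2.  There the cocycle
   becomes a locally constant function on the neighbours of v, and it extends to
   W - v because a shortest walk in W - v between neighbours of v that has length
   >= 2 would close up with v to a minimal cycle of length <= p + 2.  Conversely
   the coboundary of the indicator of one edge of a minimal cycle of length q
   gives a nonzero class in Tor_(q-3) of degree q. *)

Require Import Defs.
From mathcomp Require Import all_boot all_order all_algebra.
From mathcomp Require Import mpoly.
From mathcomp Require Import ring zify.

Set Implicit Arguments.
Unset Strict Implicit.
Unset Printing Implicit Defensive.

Import Order.TTheory GRing.Theory Num.Theory.
Local Open Scope ring_scope.

(** * Independence of Tor from the resolution *)

Section HomogeneousParts.

Variables (k : fieldType) (n : nat).
Implicit Types (p q : {mpoly k[n]}) (c : int).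

Definition hpart c p : {mpoly k[n]} :=
  \sum_(m <- msupp p | (mdeg m)%:Z == c) p@_m *: 'X_[m].

Lemma mcoeff_sum_msupp (P : pred 'X_{1..n}) p (m : 'X_{1..n}) :
  (\sum_(u <- msupp p | P u) p@_u *: 'X_[u])@_m = if P m then p@_m else 0.
Proof.
rewrite raddf_sum /=.
under eq_bigr => u _ do rewrite mcoeffZ mcoeffX.
case: ifPn => [Pm|nPm]; last first.
  by apply: big1 => u Pu; have [eum|] := eqVneq u m;
    [rewrite eum (negPf nPm) in Pu | rewrite mulr0].
have [mp|] := boolP (m \in msupp p); last first.
  move=> mp; rewrite (memN_msupp_eq0 mp) big_seq_cond.
  by apply: big1 => u /andP[up _]; have [eum|] := eqVneq u m;
    [rewrite -eum up in mp | rewrite mulr0].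
rewrite big_mkcond (bigD1_seq m) //= Pm eqxx mulr1 big1 ?addr0 // => u num.
by rewrite (negPf num) mulr0 if_same.
Qed.

Lemma mcoeff_hpart c p m : (hpart c p)@_m = if (mdeg m)%:Z == c then p@_m else 0.
Proof. exact: mcoeff_sum_msupp. Qed.

Lemma hpart_sum c (T : Type) (s : seq T) (F : T -> {mpoly k[n]}) :
  hpart c (\sum_(i <- s) F i) = \sum_(i <- s) hpart c (F i).
Proof.
apply/mpolyP => m; rewrite mcoeff_hpart !(raddf_sum (mcoeff m)) /=.
case: ifPn => mc; last first.
  by rewrite big1 // => i _; rewrite mcoeff_hpart (negPf mc).
by apply: eq_bigr => i _; rewrite mcoeff_hpart mc.
Qed.

Lemma hpart_id c p :
  (forall m, m \in msupp p -> c = (mdeg m)%:Z) -> hpart c p = p.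
Proof.
move=> hp; apply/mpolyP => m; rewrite mcoeff_hpart.
have [mp|mp] := boolP (m \in msupp p); first by rewrite -(hp m mp) eqxx.
by rewrite (memN_msupp_eq0 mp) if_same.
Qed.

Lemma hpartM c c' p q :
  (forall m, m \in msupp q -> c' = c + (mdeg m)%:Z) ->
  hpart c' (p * q) = hpart c p * q.
Proof.
move=> hq; apply/mpolyP => m; rewrite mcoeff_hpart !mcoeffM.
transitivity (\sum_(u : 'X_{1..n < (mdeg m).+1, (mdeg m).+1}
    | m == (u.1 + u.2)%MM) if (mdeg m)%:Z == c' then p@_u.1 * q@_u.2 else 0).
  by case: ifP => // _; rewrite big1.
apply: eq_bigr => u /eqP em; rewrite mcoeff_hpart.
have [uq|uq] := boolP ((val u.2 : 'X_{1..n}) \in msupp q); last first.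
  by rewrite (memN_msupp_eq0 uq) !mulr0 if_same.
have -> : (mdeg m)%:Z = (mdeg u.1)%:Z + (mdeg u.2)%:Z.
  by rewrite -PoszD -mdegD; congr (mdeg _)%:Z.
rewrite (hq _ uq) (inj_eq (addIr _)).
by case: ifP => // _; rewrite mul0r.
Qed.

Definition mx_homog s t (a : 'I_s -> int) (b : 'I_t -> int)
    (M : 'M[{mpoly k[n]}]_(s, t)) :=
  forall r l m, m \in msupp (M r l) -> a r = b l + (mdeg m)%:Z.

(** Replacing each entry of [N] by its component of degree [a r - b l] keeps the product, because
    the entries of [M] and [D] are homogeneous. Degrees are integers since this difference may be
    negative; the component is then zero. *)
Lemma homogeneous_factor s t u (a : 'I_s -> int) (b : 'I_t -> int)
    (c : 'I_u -> int) (M : 'M_(s, u)) (N : 'M_(s, t)) (D : 'M_(t, u)) :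
  mx_homog a c M -> mx_homog b c D -> M = N *m D ->
  exists2 N' : 'M_(s, t), mx_homog a b N' & M = N' *m D.
Proof.
move=> hM hD eM; exists (\matrix_(r, l) hpart (a r - b l) (N r l)).
  move=> r l m; rewrite mxE mcoeff_msupp mcoeff_hpart.
  by have [->|_] := eqVneq (mdeg m)%:Z _; [rewrite addrC subrK | rewrite eqxx].
apply/matrixP => r j.
have <- : hpart (a r - c j) (M r j) = M r j.
  by apply: hpart_id => m /hM ->; rewrite addrC addKr.
rewrite eM !mxE hpart_sum; apply: eq_bigr => l _; rewrite mxE.
by apply: hpartM => m /hD ->; rewrite opprD addrA subrK.
Qed.

Lemma mx_homogM s t u (a : 'I_s -> int) (b : 'I_t -> int) (c : 'I_u -> int)
    (M : 'M_(s, t)) (N : 'M_(t, u)) :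
  mx_homog a b M -> mx_homog b c N -> mx_homog a c (M *m N).
Proof.
move=> hM hN r l m; rewrite mxE => /msupp_sum_le /flattenP[_ /mapP[j _ ->]].
move=> /msuppM_le /allpairsP[[m1 m2] /= [h1 h2 ->]].
by rewrite (hM _ _ _ h1) (hN _ _ _ h2) mdegD PoszD addrAC addrA.
Qed.

End HomogeneousParts.

(** * Chain maps between two graded free resolutions *)

Section Comparison.

Variables (k : fieldType) (n : nat) (I : {mpoly k[n]} -> Prop).
Implicit Types F G : graded_free_resolution I.

Local Notation tens := (map_mx (mcoeff 0%MM)).

(** The resolution is continued below position 0 by a copy of S generated in degree 0, so that
    exactness and lifting need no separate case for the augmentation. *)
Definition pre_rank F i := if i is j.+1 then gfr_rank F j else 1%N.

Definition pre_deg F i : 'I_(pre_rank F i) -> int :=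
  match i with 0%N => fun=> 0 | j.+1 => @gfr_deg _ _ _ F j end.

Definition boundary F i : 'M[{mpoly k[n]}]_(gfr_rank F i, pre_rank F i) :=
  match i with 0%N => gfr_aug F | j.+1 => gfr_diff F j end.

Lemma boundary_homog F i :
  mx_homog (@gfr_deg _ _ _ F i) (@pre_deg F i) (boundary F i).
Proof.
case: i => [|i] r l m /=; last exact: gfr_diff_homog.
by rewrite ord1 add0r; apply: gfr_aug_homog.
Qed.

Lemma diff_homog F i :
  mx_homog (@gfr_deg _ _ _ F i.+1) (@gfr_deg _ _ _ F i) (gfr_diff F i).
Proof. exact: gfr_diff_homog. Qed.

Lemma exact_row F i (v : 'rV_(gfr_rank F i)) :
  v *m boundary F i = 0 <-> exists w, v = w *m gfr_diff F i.
Proof. by case: i v => [|i] v; [apply: gfr_exact0 | apply: gfr_exactS]. Qed.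

Lemma factor_rows s t u (M : 'M[{mpoly k[n]}]_(s, u)) (D : 'M_(t, u)) :
  (forall r, exists w, row r M = w *m D) -> exists N : 'M_(s, t), M = N *m D.
Proof.
move=> /fin_all_exists[f hf]; exists (\matrix_r f r).
by apply/row_matrixP => r; rewrite row_mul rowK.
Qed.

Lemma exact_lift F i s (M : 'M_(s, gfr_rank F i)) :
  M *m boundary F i = 0 -> exists N, M = N *m gfr_diff F i.
Proof.
move=> hM; apply: factor_rows => r; apply/exact_row.
by rewrite -row_mul hM row0.
Qed.

Lemma diff_boundary F i : gfr_diff F i *m boundary F i = 0.
Proof.
apply/row_matrixP => r; rewrite row_mul row0; apply/exact_row.
by exists (delta_mx 0 r); rewrite rowE.
Qed.

Lemma aug_factor F G : exists N, gfr_aug G = N *m gfr_aug F.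
Proof.
apply: factor_rows => r.
have /(gfr_aug_image F)[w hw] : I (gfr_aug G r 0).
  apply/(gfr_aug_image G); exists (delta_mx 0 r); rewrite -rowE.
  by apply/rowP => j; rewrite !mxE ord1 mulr1n.
by exists w; rewrite hw; apply/rowP => j; rewrite !mxE ord1 mulr1n.
Qed.

(* The two chain maps between [F] and [G] compose to a map homotopic to the
   identity of [G]; [1 - g f - h d] is the remaining half [d h] of the
   homotopy, so it kills the cycles of [G (x) k].  Only [g] has to be
   homogeneous. *)
Lemma comparison F G i :
  exists g f h,
  [/\ mx_homog (@gfr_deg _ _ _ G i) (@gfr_deg _ _ _ F i) g,
      gfr_diff G i *m g *m boundary F i = 0,
      gfr_diff F i *m f *m boundary G i = 0,
      gfr_diff G i *m (1%:M - g *m f - h *m gfr_diff G i) = 0 &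
      (forall v : 'rV_(gfr_rank G i), gfr_tensor_cycle v ->
        @gfr_tensor_cycle _ _ _ F i (v *m tens g)) /\
      (forall v : 'rV_(gfr_rank G i), gfr_tensor_cycle v ->
        v *m tens (1%:M - g *m f - h *m gfr_diff G i) = 0)].
Proof.
elim: i => [|i [g [f [h [hg dg df dR [cg cR]]]]]].
  have [g0 eg0] := aug_factor F G; have [f ef] := aug_factor G F.
  have [g hg eg] := homogeneous_factor (@boundary_homog G 0)
    (@boundary_homog F 0) eg0; rewrite /= in eg.
  have [h eh] : exists h, 1%:M - g *m f = h *m gfr_diff G 0.
    apply: exact_lift; rewrite mulmxBl mul1mx -mulmxA /=.
    by rewrite -ef -eg subrr.
  exists g, f, h; rewrite eh subrr !mulmx0; split=> //.
  - by rewrite -mulmxA -eg (diff_boundary G 0).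
  - by rewrite -mulmxA -ef (diff_boundary F 0).
  - by split=> // v _; rewrite raddf0 mulmx0.
have [g0 eg0] := exact_lift dg.
have [f' ef] := exact_lift df.
have [g' hg' eg] := homogeneous_factor (mx_homogM (@diff_homog G i) hg)
    (@diff_homog F i) eg0.
(* By [dR] the left side is killed by the boundary, so it lifts. Once the lift is subtracted from
   [1 - g' f'], exactly [d h] remains. *)
have [h' eh] : exists h', 1%:M - g' *m f' - gfr_diff G i *m h
    = h' *m gfr_diff G i.+1.
  apply: exact_lift => /=; rewrite !mulmxBl mul1mx -!mulmxA -ef.
  by rewrite [g' *m _]mulmxA -eg -[RHS]dR !mulmxBr mulmx1 !mulmxA.
exists g', f', h'; rewrite -eh opprB addrCA subrr addr0.
split=> //=.
- by rewrite -mulmxA -eg mulmxA diff_boundary mul0mx.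
- by rewrite -mulmxA -ef mulmxA diff_boundary mul0mx.
- by rewrite mulmxA (diff_boundary G i.+1) mul0mx.
split=> v vc /=; last by rewrite map_mxM mulmxA [v *m _]vc mul0mx.
by rewrite -mulmxA -map_mxM -eg map_mxM mulmxA [v *m _]vc mul0mx.
Qed.

(** A cycle [v] of [G (x) k] differs from [v g f] by a boundary. As [g] is homogeneous, [v g] is a
    cycle of degree [d] in [F (x) k], hence a boundary, and [f] carries boundaries to boundaries. *)
Lemma tor_degree_vanishes_indep F G i d :
  tor_degree_vanishes F i d -> tor_degree_vanishes G i d.
Proof.
move=> Fid v vd vc.
have [g [f [h [hg _ df _ [cg cR]]]]] := comparison F G i.
have [f' ef] := exact_lift df.
have [w _ ew] : exists2 w : 'rV_(gfr_rank F i.+1),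
    gfr_tensor_homog d w & v *m tens g = w *m gfr_tensor_diff F i.
  apply: Fid; last exact: cg.
  move=> j; rewrite mxE => /negP nz; apply/eqP/negPn/negP => djd; apply: nz.
  apply/eqP/big1 => l _; rewrite mxE.
  have [->|/vd dl] := eqVneq (v 0 l) 0; first by rewrite mul0r.
  have [->|] := eqVneq ((g l j)@_0%MM) 0; first by rewrite mulr0.
  rewrite -mcoeff_msupp => /hg; rewrite mdeg0 addr0 dl => edj.
  by rewrite edj eqxx in djd.
pose u := w *m tens f' + v *m tens h.
have ev : v = u *m gfr_tensor_diff G i.
  have /eqP := cR v vc; rewrite !map_mxB map_mx1 !map_mxM !mulmxBr mulmx1.
  rewrite !mulmxA -addrA -opprD subr_eq0 => /eqP {1}->.
  by rewrite ew mulmxDl -!mulmxA -(map_mxM _ (gfr_diff F i)) ef map_mxM.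
(* Neither [f'] nor [h] is known to be homogeneous, so only the part of [u] in degree [d] is kept.
   Nonzero entries of the tensored differential join generators of equal degree, so nothing is
   lost. *)
exists (\row_j (if gfr_deg j == d then u 0 j else 0)).
  by move=> j; rewrite mxE; have [->|_] := eqVneq (gfr_deg j) d; rewrite ?eqxx.
apply/rowP => j; rewrite mxE.
have [djd|djd] := eqVneq (gfr_deg j) d.
  rewrite {1}ev mxE; apply: eq_bigr => l _; rewrite !mxE.
  case: eqP => // dl; rewrite mul0r.
  have [->|] := eqVneq ((gfr_diff G i l j)@_0%MM) 0; first by rewrite mulr0.
  rewrite -mcoeff_msupp => /gfr_diff_homog; rewrite mdeg0 addr0 djd => edj.
  by rewrite edj in dl.
rewrite big1 => [|l _].
  by apply/eqP/negPn/negP => /vd edj; rewrite edj eqxx in djd.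
rewrite !mxE; case: eqP => dl; last by rewrite mul0r.
have [->|] := eqVneq ((gfr_diff G i l j)@_0%MM) 0; first by rewrite mulr0.
rewrite -mcoeff_msupp => /gfr_diff_homog; rewrite mdeg0 addr0 dl => edj.
by rewrite edj eqxx in djd.
Qed.

End Comparison.

(** * Signs and simplicial cochains *)

Section AlternatingSums.

Variable R : comNzRingType.

(** The terms at [(a, b)] and [(b, a)] cancel. The diagonal is assumed zero separately because
    antisymmetry does not force this in characteristic 2. *)
Lemma antisym_sum2 n (f : 'I_n -> 'I_n -> R) :
  (forall a, f a a = 0) -> (forall a b, a != b -> f a b = - f b a) ->
  \sum_a \sum_b f a b = 0.
Proof.
move=> f0 fN; rewrite pair_big /=.
rewrite (bigID (fun u : 'I_n * 'I_n => u.1 < u.2)%N) /=.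
rewrite [X in _ + X](bigID (fun u : 'I_n * 'I_n => u.2 < u.1)%N) /=.
rewrite [X in _ + (_ + X)]big1 => [|[a b] /= /andP[]]; last first.
  by rewrite -!leqNgt => ab ba; rewrite (_ : a = b) //; apply/val_inj/anti_leq/andP.
rewrite addr0 [X in _ + X](reindex_inj (h := fun u => (u.2, u.1))) /=; last first.
  by move=> [a b] [c d] [-> ->].
rewrite [X in _ + X](eq_bigl (fun u : 'I_n * 'I_n => u.1 < u.2)%N); last first.
  by move=> [a b] /=; rewrite -leqNgt; case: ltngtP.
rewrite -big_split big1 //= => -[a b] /= ab.
by rewrite fN ?addNr //; apply: contraL ab => /eqP ->; rewrite ltnn.
Qed.

Variable n : nat.
Implicit Types (a b v : 'I_n) (A B W : {set 'I_n}).

Definition sgn a A : R := (-1) ^+ #|[set b in A | (b < a)%N]|.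

(** The factor by which inserting [b] into a set changes [sgn a]; its antisymmetry makes the
    differentials below square to zero. *)
Definition inv_sgn a b : R := if (b < a)%N then -1 else 1.

Lemma inv_sgnC a b : a != b -> inv_sgn a b = - inv_sgn b a.
Proof.
rewrite /inv_sgn -val_eqE /=; case: ltngtP => // _ _; last by rewrite opprK.
Qed.

Lemma inv_sgn_sqr a b : inv_sgn a b * inv_sgn a b = 1.
Proof. by rewrite /inv_sgn; case: ifP; rewrite ?mulrNN mulr1. Qed.

Lemma sgn_sqr a A : sgn a A * sgn a A = 1.
Proof. by rewrite -expr2 sqrr_sign. Qed.

Lemma sgnU a A B : [disjoint A & B] -> sgn a (A :|: B) = sgn a A * sgn a B.
Proof.
move=> dAB; rewrite -exprD -cardsUI [X in (_ + X)%N](_ : _ = 0%N).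
  by rewrite addn0; congr (_ ^+ #|pred_of_set _|); apply/setP => b;
    rewrite !inE andb_orl.
apply/eqP; rewrite cards_eq0; apply/eqP/setP => b; rewrite !inE.
by case: (boolP (b \in A)) => //= /(disjointFr dAB) ->; rewrite andbF.
Qed.

Lemma sgnU1 a b A : b \notin A -> sgn a (b |: A) = inv_sgn a b * sgn a A.
Proof.
move=> bA; rewrite sgnU ?disjoints1 //; congr (_ * _); rewrite /sgn /inv_sgn.
have -> : [set x in [set b] | (x < a)%N] = if (b < a)%N then [set b] else set0.
  apply/setP => x; rewrite !inE; case: ifP => ba; rewrite !inE;
  by case: eqP => // ->; rewrite ba.
by case: ifP; rewrite ?cards1 ?cards0 ?expr1.
Qed.

Lemma sgn_self a A : a \notin A -> sgn a (a |: A) = sgn a A.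
Proof. by move=> aA; rewrite sgnU1 // /inv_sgn ltnn mul1r. Qed.

Lemma sgnD1 a b A : b \in A -> sgn a A = inv_sgn a b * sgn a (A :\ b).
Proof. by move=> bA; rewrite -{1}(setD1K bA) sgnU1 // !inE eqxx. Qed.

Lemma sgnD1_self a A : a \in A -> sgn a (A :\ a) = sgn a A.
Proof. by move=> aA; rewrite [RHS](sgnD1 _ aA) /inv_sgn ltnn mul1r. Qed.

Implicit Types z w c : {set 'I_n} -> R.

(** The augmented simplicial coboundary in all dimensions at once: a cochain of dimension [t - 1] is
    given by the values on sets with [t] elements, the empty set included. *)
Definition delta z B : R := \sum_(b in B) sgn b B * z (B :\ b).

Lemma eq_delta z w B :
  (forall b, b \in B -> z (B :\ b) = w (B :\ b)) -> delta z B = delta w B.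
Proof. by move=> zw; apply: eq_bigr => b bB; rewrite zw. Qed.

Lemma delta_eq0 z B : (forall b, b \in B -> z (B :\ b) = 0) -> delta z B = 0.
Proof. by move=> z0; apply: big1 => b bB; rewrite z0 ?mulr0. Qed.

Lemma deltaB z w B : delta (fun C => z C - w C) B = delta z B - delta w B.
Proof. by rewrite /delta -sumrB; apply: eq_bigr => b _; rewrite mulrBr. Qed.

Lemma deltaD z w B : delta (fun C => z C + w C) B = delta z B + delta w B.
Proof. by rewrite /delta -big_split; apply: eq_bigr => b _; rewrite mulrDr. Qed.

Lemma delta_delta z B : delta (delta z) B = 0.
Proof.
pose f a b := if (a \in B) && (b \in B :\ a)
  then sgn a B * (sgn b (B :\ a) * z (B :\ a :\ b)) else 0.
transitivity (\sum_a \sum_b f a b).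
  rewrite /delta big_mkcond; apply: eq_bigr => a _; rewrite /f.
  case: ifP => aB /=; last by rewrite big1.
  by rewrite mulr_sumr big_mkcond.
apply: antisym_sum2 => [a|a b ab]; rewrite /f !inE ?eqxx ?andbF //.
rewrite (eq_sym b a) ab /= [in LHS]andbC; case: ifP => [/andP[bB aB]|]; last first.
  by rewrite oppr0.
have aBb : a \in B :\ b by rewrite !inE ab.
have bBa : b \in B :\ a by rewrite !inE eq_sym ab.
rewrite (sgnD1 a bB) (sgnD1 b aB) (inv_sgnC ab).
have -> : B :\ a :\ b = B :\ b :\ a by rewrite !setDDl setUC.
ring.
Qed.

Definition cone v c B : R := if v \in B then 0 else sgn v B * c (v |: B).

(** If [v] is in [B], only the summand [b = v] survives. Otherwise the summand of [v] in
    [delta c (v |: B)] gives [c B] and the others cancel [delta (cone v c) B]. Thus the full simplex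
    is contractible. *)
Lemma cone_homotopy v c B : delta (cone v c) B + cone v (delta c) B = c B.
Proof.
rewrite /cone; have [vB|vB] := boolP (v \in B).
  rewrite addr0 /delta (bigD1 v) //= !inE eqxx /= big1 ?addr0.
    by rewrite setD1K // sgnD1_self // mulrA sgn_sqr mul1r.
  by move=> b /andP[_ bv]; rewrite !inE eq_sym bv vB mulr0.
rewrite {2}/delta big_setU1 //= setU1K // sgn_self // mulrDr mulrA sgn_sqr.
rewrite mul1r addrCA -[RHS]addr0; congr (_ + _).
rewrite mulr_sumr /delta -big_split big1 //= => b bB.
have bv : b != v by apply: contraNneq vB => <-.
rewrite !inE (negPf vB) andbF.
have -> : v |: B :\ b = (v |: B) :\ b.
  apply/setP => x; rewrite !inE; case: eqP => //= ->; by rewrite eq_sym bv.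
rewrite (sgnD1 v bB) (sgnU1 b vB) (inv_sgnC bv).
have -> : forall x y u : R, x * (y * u) + inv_sgn v b * y * (- inv_sgn v b * x * u)
    = (1 - inv_sgn v b * inv_sgn v b) * (x * y * u) by move=> x y u; ring.
by rewrite inv_sgn_sqr subrr mul0r.
Qed.

End AlternatingSums.

(** * The Koszul-type resolution of a Stanley-Reisner ideal *)

Section VariableDivision.

Variables (k : fieldType) (n : nat).
Implicit Types (p q : {mpoly k[n]}) (a b : 'I_n) (m : 'X_{1..n}).

(** Terms without ['X_a] are discarded, which makes this an additive left inverse of multiplication
    by ['X_a] that commutes with the other variables. *)
Definition divX a p : {mpoly k[n]} :=
  \sum_(m <- msupp p | (0 < m a)%N) p@_m *: 'X_[m - U_(a)].

Definition free_of a p := forall m, (0 < m a)%N -> p@_m = 0.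

Lemma mcoeffXM m u p :
  ('X_[u] * p)@_m = if (u <= m)%MM then p@_(m - u)%MM else 0.
Proof.
case: ifPn => um; first by rewrite -{1}(submK um) addmC mulrC mcoeffMX.
rewrite mcoeffM big1 // => -[x y] /= /eqP em; rewrite mcoeffX.
by have [eu|] := eqVneq u x; [rewrite em eu lem_addr in um | rewrite mul0r].
Qed.

Lemma mcoeff_divX a p m : (divX a p)@_m = p@_(m + U_(a)).
Proof.
have aUa : (0 < (m + U_(a))%MM a)%N by rewrite mnmDE mnm1E eqxx addn1.
have := mcoeff_sum_msupp (fun u => 0 < u a)%N p (m + U_(a)).
rewrite aUa => <-; rewrite (raddf_sum (mcoeff m)) (raddf_sum (mcoeff _)) /=; apply: eq_bigr => u ua.
rewrite !mcoeffZ !mcoeffX; congr (_ * (_ : bool)%:R).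
have Uu : (U_(a) <= u)%MM.
  by apply/mnm_lepP => i; rewrite mnm1E; case: eqP => // <-.
by rewrite -{2}(submK Uu) eqm_add2r.
Qed.

Lemma divXD a p q : divX a (p + q) = divX a p + divX a q.
Proof. by apply/mpolyP => m; rewrite mcoeffD !mcoeff_divX mcoeffD. Qed.

Lemma divX0 a : divX a 0 = 0.
Proof. by apply/mpolyP => m; rewrite mcoeff_divX !mcoeff0. Qed.

Lemma divXN a p : divX a (- p) = - divX a p.
Proof. by apply/mpolyP => m; rewrite mcoeffN !mcoeff_divX mcoeffN. Qed.

Lemma divX_sum a (I : Type) (s : seq I) (P : pred I) (F : I -> {mpoly k[n]}) :
  divX a (\sum_(i <- s | P i) F i) = \sum_(i <- s | P i) divX a (F i).
Proof. exact: (big_morph _ (divXD a) (divX0 a)). Qed.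

Lemma divX_sgn a b A p :
  divX a (sgn {mpoly k[n]} b A * p) = sgn {mpoly k[n]} b A * divX a p.
Proof.
rewrite /sgn -signr_odd; case: (odd _); last by rewrite expr0 !mul1r.
by rewrite expr1 !mulN1r divXN.
Qed.

Lemma divX_mulX a p : divX a ('X_a * p) = p.
Proof.
apply/mpolyP => m; rewrite mcoeff_divX mcoeffXM lem_addl.
by rewrite addmK.
Qed.

Lemma divX_mulXC a b p : a != b -> divX a ('X_b * p) = 'X_b * divX a p.
Proof.
move=> ab; apply/mpolyP => m; rewrite mcoeff_divX !mcoeffXM mcoeff_divX.
have -> : (U_(b) <= m + U_(a))%MM = (U_(b) <= m)%MM.
  by apply/mnm_lepP/mnm_lepP => h i; move: (h i); rewrite mnmDE !mnm1E;
    case: (b =P i) => // <-; rewrite (negPf ab) addn0.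
case: ifP => // /mnm_lepP bm; congr (_@_ _); apply/mnmP => i.
by rewrite !(mnmDE, mnmBE, mnm1E); move: (bm i); rewrite mnm1E => bi; rewrite addnBAC.
Qed.

Lemma mcoeff_remX a p m :
  (p - 'X_a * divX a p)@_m = if (0 < m a)%N then 0 else p@_m.
Proof.
rewrite mcoeffB mcoeffXM mcoeff_divX.
have -> : (U_(a) <= m)%MM = (0 < m a)%N.
  apply/mnm_lepP/idP => [/(_ a)|ma i]; rewrite mnm1E ?eqxx //.
  by case: eqP => // <-.
case: ifP => [ma|_]; last by rewrite subr0.
rewrite submK ?subrr //; apply/mnm_lepP => i; rewrite mnm1E.
by case: eqP => // <-.
Qed.

Lemma free_of_divX a b p : free_of b p -> free_of b (divX a p).
Proof.
by move=> pb m mb; rewrite mcoeff_divX pb // mnmDE ltn_addr.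
Qed.

Lemma free_ofD a p q : free_of a p -> free_of a q -> free_of a (p + q).
Proof. by move=> pa qa m ma; rewrite mcoeffD pa // qa // addr0. Qed.

End VariableDivision.

(** * The complex on pairs of disjoint sets and its exactness *)

Section KoszulComplex.

Variables (k : fieldType) (n : nat) (D : {set {set 'I_n}}).
Hypothesis closedD : forall A B : {set 'I_n}, A \subset B -> B \in D -> A \in D.

Local Notation S := {mpoly k[n]}.
Implicit Types (a b : 'I_n) (A B W : {set 'I_n}) (L : seq 'I_n).
Implicit Types (f g h : {set 'I_n} -> {set 'I_n} -> S).

(* The pair [(A, B)] indexes the generator [e_A (x) m_B], of degree
   [#|A| + #|B|]; the differential is
   [e_A m_B |-> sum_(a in A) +- (x_a e_(A - a) m_B - e_(A - a) m_(B + a))]. *)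
Definition cells i : {set {set 'I_n} * {set 'I_n}} :=
  [set x : {set 'I_n} * {set 'I_n} | [&& #|x.1| == i, [disjoint x.1 & x.2] & x.2 \notin D]].

Definition supported i f := forall A B, (A, B) \notin cells i -> f A B = 0.

(** Transpose of the rule on generators: what the coefficient at [(A, B)] receives through [a]. Only
    one of the two terms can occur, since [(a |: A, B)] is not a cell when [a] is in [B]. *)
Definition kpart a f A B : S :=
  if a \in A then 0 else
  if a \in B then - f (a |: A) (B :\ a) else 'X_a * f (a |: A) B.

Definition kdiff f A B : S := \sum_a sgn S a A * kpart a f A B.

(** In the tensor factor of [x_a] the differential is [e_a |-> x_a - m_a]. Up to sign, the homotopy
    sends a coefficient [p] to [divX a p] times [e_a], and kills the multiples of [e_a] and
    [m_a]. *)
Definition khomotopy a f A B : S :=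
  if (a \in A) && (a \notin B) then sgn S a A * divX a (f (A :\ a) B) else 0.

Lemma eq_kdiff f g A B : (forall A B, f A B = g A B) -> kdiff f A B = kdiff g A B.
Proof. by move=> fg; apply: eq_bigr => a _; rewrite /kpart !fg. Qed.

Lemma kdiffD f g A B :
  kdiff (fun A B => f A B + g A B) A B = kdiff f A B + kdiff g A B.
Proof.
rewrite /kdiff -big_split; apply: eq_bigr => a _ /=; rewrite /kpart.
by case: ifP => _; [|case: ifP => _]; ring.
Qed.

Lemma kdiffN f A B : kdiff (fun A B => - f A B) A B = - kdiff f A B.
Proof.
rewrite /kdiff -sumrN; apply: eq_bigr => a _ /=; rewrite /kpart.
by case: ifP => _; [|case: ifP => _]; ring.
Qed.

Lemma kdiffZ (p : S) f A B : kdiff (fun A B => p * f A B) A B = p * kdiff f A B.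
Proof.
rewrite /kdiff mulr_sumr; apply: eq_bigr => a _ /=; rewrite /kpart.
by case: ifP => _; [|case: ifP => _]; ring.
Qed.

Lemma kdiff_sum (I : Type) (s : seq I) (F : I -> {set 'I_n} -> {set 'I_n} -> S) A B :
  kdiff (fun A B => \sum_(i <- s) F i A B) A B = \sum_(i <- s) kdiff (F i) A B.
Proof.
elim: s => [|i s IHs].
  rewrite big_nil [LHS]big1 // => a _; rewrite /kpart !big_nil.
  by rewrite oppr0 !mulr0 !if_same mulr0.
rewrite big_cons -IHs -kdiffD; apply: eq_kdiff => A' B'.
by rewrite big_cons.
Qed.

Lemma kdiff_supported i f : supported i.+1 f -> supported i (kdiff f).
Proof.
move=> sf A B; rewrite inE /= => nAB; apply: big1 => a _; rewrite /kpart.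
case: ifPn => [_|aA]; first by rewrite mulr0.
have cardaA : (#|a |: A| == i.+1) = (#|A| == i) by rewrite cardsU1 aA.
case: ifPn => [aB|aB]; rewrite sf ?oppr0 ?mulr0 // inE /= cardaA;
  apply: contra nAB => /and3P[-> dAB BD] /=.
  apply/andP; split; last by apply: contra BD; apply: closedD; apply: subsetDl.
  apply/pred0P => x /=; apply/negbTE/andP => -[xA xB].
  have xa : x != a by apply: contraNneq aA => <-.
  by move: (disjointFr dAB (setU1r a xA)); rewrite !inE xa xB.
rewrite BD andbT; apply: disjointWl dAB; exact: subsetUr.
Qed.

Lemma kpartC a b f A B : a != b -> kpart a (kpart b f) A B = kpart b (kpart a f) A B.
Proof.
move=> ab; have ba : b != a by rewrite eq_sym.
rewrite /kpart !inE (negPf ab) (negPf ba) /=.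
have -> : b |: (a |: A) = a |: (b |: A) by rewrite !setUA (setUC [set b]).
have -> : B :\ b :\ a = B :\ a :\ b by rewrite !setDDl setUC.
case: (a \in A); case: (b \in A) => //; rewrite ?mulr0 ?oppr0 ?if_same //.
by case: (a \in B); case: (b \in B) => //; ring.
Qed.

(** The operators [kpart a] commute, so the antisymmetry of the signs cancels the double sum in
    pairs. *)
Lemma kdiff_kdiff f A B : kdiff (kdiff f) A B = 0.
Proof.
pose F a b := if (a \notin A) && (b \notin a |: A)
  then sgn S a A * sgn S b (a |: A) * kpart a (kpart b f) A B else 0.
transitivity (\sum_a \sum_b F a b).
  apply: eq_bigr => a _; rewrite {1}/kpart /F; case: ifP => aA /=.
    by rewrite mulr0 big1.
  transitivity (\sum_b sgn S a A * sgn S b (a |: A) * kpart a (kpart b f) A B).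
    rewrite /kdiff -sumrN !mulr_sumr; case: ifP => aB; rewrite ?mulr_sumr;
    by apply: eq_bigr => b _; rewrite [kpart a _ A B]/kpart aA aB; ring.
  apply: eq_bigr => b _; case: ifPn => //; rewrite negbK => bA.
  by rewrite /kpart aA bA oppr0 !mulr0 if_same mulr0.
apply: antisym_sum2 => [a|a b ab]; rewrite /F !inE ?eqxx ?andbF // !negb_or.
rewrite (eq_sym b a) ab /= [in LHS]andbC; case: ifP => [/andP[bA aA]|]; last first.
  by rewrite oppr0.
by rewrite kpartC // !sgnU1 // (inv_sgnC _ ab); ring.
Qed.

Lemma khomotopy_supported i a f : supported i f -> supported i.+1 (khomotopy a f).
Proof.
move=> sf A B nAB; rewrite /khomotopy; case: ifP => // /andP[aA aB].
rewrite sf ?divX0 ?mulr0 //; apply: contra nAB; rewrite !inE /=.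
rewrite (cardsD1 a A) aA add1n eqSS => /and3P[-> dAB ->].
rewrite andbT /=; apply/pred0P => x /=; apply/negbTE/andP => -[xA xB].
have xa : x != a by apply: contraNneq aB => <-.
have xAa : x \in A :\ a by rewrite !inE xa.
by rewrite (disjointFr dAB xAa) in xB.
Qed.

(** What the homotopy for [a] makes of a cycle: [e_a] disappears, and a term [x_a q] without [m_a]
    is traded for [q m_a]. *)
Definition kproj a f A B : S :=
  if a \in A then 0 else
  if a \in B then f A B + divX a (f A (B :\ a)) else f A B - 'X_a * divX a (f A B).

Lemma kproj_homotopy i a f : supported i f -> (forall A B, kdiff f A B = 0) ->
  forall A B, f A B - kdiff (khomotopy a f) A B = kproj a f A B.
Proof.
move=> sf df A B; rewrite /kproj; case: ifPn => aA; last first.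
  rewrite /kdiff (bigD1 a) //= big1 => [|b ba]; last first.
    rewrite /kpart /khomotopy !inE (eq_sym a) (negPf ba) (negPf aA) /=.
    by rewrite oppr0 !mulr0 !if_same mulr0.
  rewrite addr0 /kpart (negPf aA); case: ifPn => aB.
    rewrite /khomotopy !inE eqxx /= setU1K // sgn_self // mulrN opprK.
    by rewrite mulrA sgn_sqr mul1r.
  rewrite /khomotopy !inE eqxx /= aB setU1K // sgn_self //.
  by rewrite mulrCA mulrA mulrA -(mulrA 'X_a) sgn_sqr mulr1.
have [aB|aB] := boolP (a \in B).
  rewrite sf ?sub0r; last first.
    rewrite inE /=; apply/negP => /and3P[_ dAB _].
    by rewrite (disjointFr dAB aA) in aB.
  rewrite /kdiff big1 ?oppr0 // => b _; rewrite /kpart /khomotopy.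
  case: ifPn => bA; first by rewrite mulr0.
  have ab : a != b by apply: contraNneq bA => <-.
  by rewrite !inE ab aB /= !andbF !mulr0 oppr0 if_same mulr0.
(* Here the cycle condition enters: its equation at [(A :\ a, B)] is solved for ['X_a * f A B] and
   divided by ['X_a]. *)
have := df (A :\ a) B; rewrite /kdiff (bigD1 a) //=.
rewrite {1}/kpart !inE eqxx /= (negPf aB) setD1K // sgnD1_self // => /eqP.
rewrite addr_eq0 => /eqP /(congr1 (fun p => sgn S a A * divX a p)).
rewrite divX_sgn divX_mulX mulrA sgn_sqr mul1r => ->.
rewrite divXN divX_sum mulrN mulr_sumr -opprD -[RHS]oppr0; congr (- _).
rewrite [X in _ + X](bigD1 a) //= {2}/kpart aA mulr0 add0r -big_split big1 //= => b ba.
have ab : a != b by rewrite eq_sym.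
rewrite divX_sgn /kpart !inE ba /=; case: ifPn => bA.
  by rewrite divX0 !mulr0 addr0.
have eA : b |: A :\ a = (b |: A) :\ a.
  by apply/setP => x; rewrite !inE; case: eqP => //= ->; rewrite ba.
have bAa : b \notin A :\ a by rewrite !inE (negPf bA) andbF.
rewrite /khomotopy !inE aA ab (negPf aB) orbT !andbT /= eA.
rewrite (sgnD1 _ b aA) (sgnU1 _ a bA) (inv_sgnC _ ab).
have inv2 := inv_sgn_sqr S b a.
by case: ifP => bB; rewrite ?divXN ?divX_mulXC //; ring: inv2.
Qed.

(** Each [kproj a] clears [a] from [A], and [x_a] from the coefficients with [a] outside [B], while
    preserving what was achieved for the earlier variables. *)
Lemma kernel_reduction i f :
  supported i f -> (forall A B, kdiff f A B = 0) -> forall L,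
  exists2 h, supported i.+1 h &
    let g A B := f A B - kdiff h A B in
    (forall A B a, a \in L -> a \in A -> g A B = 0) /\
    (forall A B a, a \in L -> a \notin B -> free_of a (g A B)).
Proof.
move=> sf df; elim=> [|a L [h sh [gA gB]]].
  by exists (fun _ _ => 0) => //; split.
pose g A B := f A B - kdiff h A B.
have {}gA A B c : c \in L -> c \in A -> g A B = 0 by apply: gA.
have {}gB A B c : c \in L -> c \notin B -> free_of c (g A B) by apply: gB.
have sg : supported i g.
  by move=> A B nAB; rewrite /g sf // (kdiff_supported sh) // subr0.
have dg A B : kdiff g A B = 0.
  by rewrite kdiffD kdiffN df kdiff_kdiff oppr0 addr0.
exists (fun A B => h A B + khomotopy a g A B).
  by move=> A B nAB; rewrite sh // (khomotopy_supported a sg) // addr0.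
have eg A B : f A B - kdiff (fun A B => h A B + khomotopy a g A B) A B
    = kproj a g A B.
  by rewrite kdiffD opprD addrA (kproj_homotopy a sg dg).
split=> A B c; rewrite inE eg /kproj.
  case/predU1P => [->|cL] cA; first by rewrite cA.
  by rewrite !(gA _ _ _ cL cA) divX0 mulr0 addr0 subr0 !if_same.
move=> cL cB; case: ifP => _; first by move=> m _; rewrite mcoeff0.
have [aB|aB] := boolP (a \in B).
  have {}cL : c \in L.
    by case/predU1P: cL => // eca; rewrite eca aB in cB.
  apply: free_ofD; first exact: gB cL cB.
  by apply: free_of_divX; apply: gB cL _; rewrite !inE negb_and cB orbT.
move=> m mc; rewrite mcoeff_remX; case: ifP => // ma.
case/predU1P: cL => [eca|cL]; first by rewrite -eca mc in ma.
exact: gB cL cB m mc.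
Qed.

(** After all variables are treated only cells with [A] empty could survive, and there are none in
    positive homological degree. *)
Lemma kdiff_exact i f :
  supported i.+1 f -> (forall A B, kdiff f A B = 0) ->
  exists2 h, supported i.+2 h & forall A B, f A B = kdiff h A B.
Proof.
move=> sf df; have [h sh [gA _]] := kernel_reduction sf df (enum 'I_n).
exists h => // A B; apply/eqP; rewrite -subr_eq0; apply/eqP.
have [->|[a aA]] := set_0Vmem A; last by apply: gA aA; rewrite mem_enum.
by rewrite sf ?(kdiff_supported sh) ?subrr // inE /= cards0.
Qed.

Definition indm A : 'X_{1..n} := [multinom nat_of_bool (i \in A) | i < n].

Lemma sqfree_monomialE A : sqfree_monomial k A = 'X_[indm A].
Proof.
rewrite mpolyXE_id /sqfree_monomial big_mkcond; apply: eq_bigr => i _.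
by rewrite mnmE; case: ifP.
Qed.

Lemma sqfree_monomialU1 a A :
  a \notin A -> sqfree_monomial k (a |: A) = 'X_a * sqfree_monomial k A.
Proof. exact: big_setU1. Qed.

Definition kaug f : S := \sum_(B : {set 'I_n}) f set0 B * sqfree_monomial k B.

Lemma kaug_kdiff h : supported 1 h -> kaug (kdiff h) = 0.
Proof.
move=> sh; rewrite /kaug.
under eq_bigr => B _ do rewrite mulr_suml.
rewrite exchange_big big1 //= => a _.
rewrite (bigID (fun B : {set 'I_n} => a \in B)) /=.
rewrite (reindex_onto (fun B => a |: B) (fun B => B :\ a)) /=; last first.
  by move=> B aB; rewrite setD1K.
rewrite [X in X + _](eq_bigl (fun B : {set 'I_n} => a \notin B)); last first.
  move=> B; rewrite setU11 /=; apply/eqP/idP => [<-|aB]; last by rewrite setU1K.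
  by rewrite !inE eqxx.
rewrite -big_split big1 //= => B aB; rewrite /kpart !inE eqxx /= (negPf aB).
by rewrite setU1K // sqfree_monomialU1 //; ring.
Qed.

Lemma supported0_kdiff f A B : supported 0 f -> kdiff f A B = 0.
Proof.
move=> sf; apply: big1 => a _; rewrite /kpart; case: ifPn => aA.
  by rewrite mulr0.
by rewrite !sf ?oppr0 ?mulr0 ?if_same ?mulr0 // inE /= cardsU1 aA.
Qed.

(** After reduction the coefficient at [(set0, B)] involves only variables of [B]. Multiplied by
    [x^B], its monomials have support exactly [B], so the terms of different [B] cannot cancel. *)
Lemma kaug_exact f :
  supported 0 f -> kaug f = 0 ->
  exists2 h, supported 1 h & forall A B, f A B = kdiff h A B.
Proof.
move=> sf f0.
have [h sh [gA gB]] := kernel_reduction sf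
  (fun A B => supported0_kdiff A B sf) (enum 'I_n).
exists h => // A B; apply/eqP; rewrite -subr_eq0; apply/eqP.
have [->|[a aA]] := set_0Vmem A; last by apply: gA aA; rewrite mem_enum.
pose g (C : {set 'I_n}) : S := f set0 C - kdiff h set0 C; rewrite -[LHS]/(g B).
have g0 : \sum_C g C * 'X_[indm C] = 0.
  transitivity (kaug f - kaug (kdiff h)); last by rewrite f0 kaug_kdiff ?subr0.
  rewrite /kaug -sumrB.
  by apply: eq_bigr => C _; rewrite sqfree_monomialE -mulrBl.
have gfree (C : {set 'I_n}) a : a \notin C -> free_of a (g C).
  by move=> aC; apply: gB aC; rewrite mem_enum.
apply/mpolyP => u; rewrite mcoeff0.
have [/existsP[a /andP[aB ua]]|] := boolP [exists a, (a \notin B) && (0 < u a)%N].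
  exact: gfree aB u ua.
rewrite negb_exists => /forallP uB.
have {}uB a : (0 < u a)%N -> a \in B.
  by move=> ua; move: (uB a); rewrite ua andbT negbK.
move/mpolyP/(_ (indm B + u)%MM): g0; rewrite (raddf_sum (mcoeff _)) /= mcoeff0.
rewrite (bigD1 B) //= mcoeffMX big1 ?addr0 // => C CB.
(* A set [C] contributing to this coefficient lies in [B]. If it is smaller, the quotient monomial
   contains a variable of [B] outside [C], which [gfree] forbids. *)
rewrite mulrC mcoeffXM; case: ifP => // /mnm_lepP leC.
have CsubB : C \subset B.
  apply/subsetP => a aC; move: (leC a); rewrite mnmDE !mnmE aC.
  by case: (boolP (a \in B)) => // aB; rewrite add0n => /uB; rewrite (negPf aB).
have /subsetPn[a aB aC] : ~~ (B \subset C).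
  by apply: contra CB => BC; rewrite eqEsubset CsubB.
by apply: (gfree C a aC); rewrite mnmBE mnmDE !mnmE aB (negPf aC) subn0.
Qed.

(** * Row vectors as functions on cells *)

Section Rows.

Variable V : zmodType.

Definition fun_of_row i (v : 'rV[V]_#|cells i|) A B : V :=
  \sum_j if enum_val j == (A, B) then v 0 j else 0.

Definition row_of_fun i (f : {set 'I_n} -> {set 'I_n} -> V) : 'rV_#|cells i| :=
  \row_j f (enum_val j).1 (enum_val j).2.

Lemma fun_of_row_enum i (v : 'rV_#|cells i|) j :
  fun_of_row v (enum_val j).1 (enum_val j).2 = v 0 j.
Proof.
rewrite /fun_of_row (bigD1 j) //= -surjective_pairing eqxx big1 ?addr0 // => l lj.
by rewrite (inj_eq enum_val_inj) (negPf lj).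
Qed.

Lemma fun_of_row_out i (v : 'rV_#|cells i|) A B :
  (A, B) \notin cells i -> fun_of_row v A B = 0.
Proof.
move=> nAB; apply: big1 => j _; case: eqP => // ej.
by move: (enum_valP j); rewrite ej (negPf nAB).
Qed.

Lemma fun_of_rowK i (v : 'rV_#|cells i|) : row_of_fun i (fun_of_row v) = v.
Proof. by apply/rowP => j; rewrite mxE fun_of_row_enum. Qed.

Lemma row_of_fun_cell i (f : {set 'I_n} -> {set 'I_n} -> V) A B :
  (A, B) \in cells i -> fun_of_row (row_of_fun i f) A B = f A B.
Proof.
move=> AB; rewrite -[A]/((A, B).1) -{2 4}[B]/((A, B).2) -(enum_rankK_in AB AB).
by rewrite fun_of_row_enum mxE.
Qed.

Lemma row_of_funK i (f : {set 'I_n} -> {set 'I_n} -> V) :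
  (forall A B, (A, B) \notin cells i -> f A B = 0) ->
  forall A B, fun_of_row (row_of_fun i f) A B = f A B.
Proof.
move=> sf A B; have [AB|AB] := boolP ((A, B) \in cells i).
  exact: row_of_fun_cell.
by rewrite fun_of_row_out ?sf.
Qed.

End Rows.

Lemma fun_of_row_map (V W : zmodType) (phi : {additive V -> W}) i
    (v : 'rV[V]_#|cells i|) A B :
  fun_of_row (map_mx phi v) A B = phi (fun_of_row v A B).
Proof.
rewrite /fun_of_row raddf_sum; apply: eq_bigr => j _.
by rewrite mxE; case: ifP; rewrite ?raddf0.
Qed.

Definition kmatrix i : 'M[S]_(#|cells i.+1|, #|cells i|) :=
  \matrix_(j, l) kdiff (fun A B => (enum_val j == (A, B))%:R)
    (enum_val l).1 (enum_val l).2.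

Lemma kmatrixE i (v : 'rV_#|cells i.+1|) :
  v *m kmatrix i = row_of_fun i (kdiff (fun_of_row v)).
Proof.
apply/rowP => l; rewrite !mxE.
rewrite [RHS](eq_kdiff (g := fun A B =>
    \sum_j v 0 j * (enum_val j == (A, B))%:R)); last first.
  by move=> A B; apply: eq_bigr => j _; case: eqP; rewrite ?mulr1 ?mulr0.
by rewrite kdiff_sum; apply: eq_bigr => j _; rewrite mxE kdiffZ.
Qed.

Definition kaug_matrix : 'cV[S]_#|cells 0| :=
  \col_j sqfree_monomial k (enum_val j).2.

Lemma cells0 A B : ((A, B) \in cells 0) = (A == set0) && (B \notin D).
Proof.
rewrite inE /= cards_eq0; case: eqP => //= ->.
by rewrite disjoints_subset sub0set.
Qed.

Lemma kaug_matrixE (v : 'rV_#|cells 0|) :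
  v *m kaug_matrix = (kaug (fun_of_row v))%:M.
Proof.
apply/rowP => l; rewrite !mxE !ord1 mulr1n.
under [RHS]eq_bigr => B _ do rewrite mulr_suml.
rewrite exchange_big; apply: eq_bigr => j _ /=.
rewrite mxE (bigD1 (enum_val j).2) //= big1 => [|B nB].
  move: (enum_valP j); rewrite [enum_val j]surjective_pairing cells0.
  by case/andP=> /eqP <- _; rewrite eqxx addr0.
case: eqP => [ej|]; last by rewrite mul0r.
by rewrite ej eqxx in nB.
Qed.

Lemma kaug_image (f : S) :
  stanley_reisner (k := k) D f <-> exists v : 'rV_#|cells 0|, v *m kaug_matrix = f%:M.
Proof.
split=> [[c ->]|[v]].
  pose g A B := if (A, B) \in cells 0 then c B else 0.
  exists (row_of_fun 0 g); rewrite kaug_matrixE; congr (_%:M).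
  rewrite [RHS]big_mkcond; apply: eq_bigr => B _.
  rewrite row_of_funK => [|A' B' /negPf]; last by rewrite /g => ->.
  by rewrite /g cells0 eqxx inE /=; case: ifP; rewrite ?mul0r.
rewrite kaug_matrixE => /matrixP /(_ 0 0); rewrite !mxE !mulr1n => <-.
exists (fun_of_row v set0); rewrite [RHS]big_mkcond; apply: eq_bigr => B _.
rewrite inE; case: ifPn => // BD; rewrite fun_of_row_out ?mul0r //.
by rewrite cells0 eqxx BD.
Qed.

End KoszulComplex.

(** * Hochster's formula *)

Section Hochster.

Variables (k : fieldType) (n : nat) (D : {set {set 'I_n}}).
Hypothesis closedD : forall A B : {set 'I_n}, A \subset B -> B \in D -> A \in D.

Local Notation S := {mpoly k[n]}.
Local Notation cells := (cells D).
Implicit Types (a b : 'I_n) (A B C W : {set 'I_n}).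

Lemma mcoeff_sgn a A (p : S) m : (sgn S a A * p)@_m = sgn k a A * p@_m.
Proof.
rewrite /sgn -signr_odd -[in RHS]signr_odd; case: (odd _).
  by rewrite !expr1 !mulN1r mcoeffN.
by rewrite !expr0 !mul1r.
Qed.

Definition cell_deg i (j : 'I_#|cells i|) : int :=
  (#|(enum_val j).1| + #|(enum_val j).2|)%:Z.

Lemma kmatrix_homog i : mx_homog (@cell_deg i.+1) (@cell_deg i) (kmatrix k D i).
Proof.
move=> j l m; rewrite mxE mcoeff_msupp; apply: contraNeq => ndeg.
rewrite (raddf_sum (mcoeff m)) big1 //= => a _; rewrite mcoeff_sgn.
move: ndeg; rewrite /cell_deg /kpart; case: (enum_val l) => A B /=.
case: ifPn => aA; first by rewrite mcoeff0 mulr0.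
case: ifPn => aB ndeg; case: eqP => [ej|]; rewrite ?oppr0 ?mulr0 ?mcoeff0 ?mulr0 //.
  rewrite mcoeffN mcoeff1; have [m0|] := eqVneq m 0%MM; last by rewrite oppr0 mulr0.
  move: ndeg; rewrite ej m0 mdeg0 addr0 /= cardsU1 aA (cardsD1 a B) aB.
  by rewrite addnA (addnC 1%N) eqxx.
rewrite mulr1 mcoeffX; have [m0|] := eqVneq U_(a)%MM m; last by rewrite mulr0.
by move: ndeg; rewrite ej -m0 mdeg1 /= cardsU1 aA -PoszD addn1 addnC addnS addnC eqxx.
Qed.

Lemma kaug_homog (j : 'I_#|cells 0|) (m : 'X_{1..n}) :
  m \in msupp (kaug_matrix k D j 0) -> cell_deg j = (mdeg m)%:Z.
Proof.
rewrite mxE sqfree_monomialE => /mem_msuppXP <-; rewrite /cell_deg.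
move: (enum_valP j); case: (enum_val j) => A B /=.
rewrite cells0 => /andP[/eqP -> _]; rewrite cards0 add0n mdegE.
by rewrite -sum1_card big_mkcond; congr Posz; apply: eq_bigr => i _; rewrite mnmE; case: ifP.
Qed.

Lemma kmatrix_complex i (w : 'rV[S]_#|cells i.+2|) :
  w *m kmatrix k D i.+1 *m kmatrix k D i = 0.
Proof.
rewrite !kmatrixE; apply/rowP => j; rewrite !mxE.
rewrite (eq_kdiff (g := kdiff (fun_of_row w))) ?kdiff_kdiff // => A B.
apply: row_of_funK; apply: kdiff_supported => // A' B'; exact: fun_of_row_out.
Qed.

Lemma kmatrix_exact i (v : 'rV[S]_#|cells i.+1|) :
  v *m kmatrix k D i = 0 <-> exists w, v = w *m kmatrix k D i.+1.
Proof.
split=> [|[w ->]]; last exact: kmatrix_complex.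
have sv : supported D i.+1 (fun_of_row v) by move=> A B; apply: fun_of_row_out.
rewrite kmatrixE => v0.
have dv A B : kdiff (fun_of_row v) A B = 0.
  rewrite -(row_of_funK (kdiff_supported closedD sv)) v0.
  by rewrite /fun_of_row big1 // => j _; rewrite mxE if_same.
have [h sh eh] := kdiff_exact closedD sv dv.
exists (row_of_fun D i.+2 h); rewrite kmatrixE -[LHS]fun_of_rowK.
apply/rowP => j; rewrite !mxE eh; apply: eq_kdiff => A B.
by rewrite row_of_funK.
Qed.

Lemma kaug_matrix_exact (v : 'rV[S]_#|cells 0|) :
  v *m kaug_matrix k D = 0 <-> exists w, v = w *m kmatrix k D 0.
Proof.
split=> [|[w ->]].
  rewrite kaug_matrixE => /matrixP/(_ 0 0); rewrite !mxE mulr1n => v0.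
  have sv : supported D 0 (fun_of_row v) by move=> A B; apply: fun_of_row_out.
  have [h sh eh] := kaug_exact closedD sv v0.
  exists (row_of_fun D 1 h); rewrite kmatrixE -[LHS]fun_of_rowK.
  apply/rowP => j; rewrite !mxE eh; apply: eq_kdiff => A B.
  by rewrite row_of_funK.
have sw : supported D 1 (fun_of_row w) by move=> A B; apply: fun_of_row_out.
rewrite kmatrixE kaug_matrixE -[RHS](raddf0 (scalar_mx (n := 1))) -(kaug_kdiff sw).
congr (_%:M); apply: eq_bigr => B _; congr (_ * _).
by apply: row_of_funK; apply: kdiff_supported.
Qed.

Definition koszul_resolution : graded_free_resolution (stanley_reisner (k := k) D) :=
  GradedFreeResolution kaug_homog kmatrix_homog (@kaug_image k n D)
    kaug_matrix_exact kmatrix_exact.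

Definition kdiff0 (c : {set 'I_n} -> {set 'I_n} -> k) A B : k :=
  - \sum_(b in B) if b \in A then 0 else sgn k b A * c (b |: A) (B :\ b).

Lemma kmatrix_tensor i (v : 'rV[k]_#|cells i.+1|) :
  v *m map_mx (mcoeff 0%MM) (kmatrix k D i) = row_of_fun D i (kdiff0 (fun_of_row v)).
Proof.
have {1}-> : v = map_mx (mcoeff 0%MM) (map_mx (@mpolyC n k) v).
  by apply/rowP => j; rewrite !mxE mcoeffC eqxx mulr1.
rewrite -map_mxM kmatrixE; apply/rowP => l; rewrite !mxE.
rewrite (raddf_sum (mcoeff _)) /kdiff0 -sumrN [RHS]big_mkcond /=.
apply: eq_bigr => a _; rewrite mcoeff_sgn /kpart !fun_of_row_map.
case: ifP => _; first by rewrite mcoeff0 mulr0 oppr0 if_same.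
case: ifP => _; first by rewrite mcoeffN mcoeffC eqxx mulr1 mulrN.
rewrite mcoeffXM; case: ifP => [/mnm_lepP /(_ a)|_]; last by rewrite mulr0.
by rewrite mnm1E eqxx mnmE.
Qed.

(** Vanishing of the cohomology of the full simplex on [W] relative to [Delta_W], on sets with [m]
    elements. By the long exact sequence this is the reduced cohomology of [Delta_W] in dimension
    [m - 2]. *)
Definition relatively_acyclic W m :=
  forall c : {set 'I_n} -> k,
    (forall B, B \in D -> c B = 0) ->
    (forall B, B \subset W -> #|B| = m.+1 -> delta c B = 0) ->
  exists w : {set 'I_n} -> k,
    (forall B, B \in D -> w B = 0) /\
    (forall B, B \subset W -> #|B| = m -> delta w B = c B).

Definition twist W B : k := \prod_(b in B) sgn k b W.

Lemma twist_sqr W B : twist W B * twist W B = 1.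
Proof. by rewrite -big_split big1 //= => b _; rewrite sgn_sqr. Qed.

(* Multiplying by [twist W] turns the signs [sgn b A] of the Koszul complex
   into the signs [sgn b (W - A)] of the simplicial coboundary. *)
Lemma delta_twist W (c : {set 'I_n} -> {set 'I_n} -> k) B : B \subset W ->
  delta (fun C => twist W C * c (W :\: C) C) B = - (twist W B * kdiff0 c (W :\: B) B).
Proof.
move=> BW; rewrite /kdiff0 mulrN opprK mulr_sumr; apply: eq_bigr => b bB.
rewrite inE bB /=; have -> : W :\: (B :\ b) = b |: W :\: B.
  apply/setP => x; rewrite !inE negb_and negbK; case: eqP => //= ->.
  by rewrite (subsetP BW _ bB).
rewrite [in RHS]/twist (big_setD1 b bB) /= -/(twist W _).
have -> : sgn k b W = sgn k b B * sgn k b (W :\: B).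
  rewrite -sgnU; last by apply/pred0P => x; rewrite /= !inE; case: (x \in B).
  congr (sgn _ _ _); apply/setP => x; rewrite !inE.
  by case: (boolP (x \in B)) => //= /(subsetP BW).
have s2 := sgn_sqr k b (W :\: B); ring: s2.
Qed.

Lemma cells_compl i m W B : #|W| = (i + m)%N -> B \subset W -> #|B| = m ->
  ((W :\: B, B) \in cells i) = (B \notin D).
Proof.
move=> cW BW cB; rewrite inE /= cardsDS // cW cB addnK eqxx /=.
by have -> : [disjoint W :\: B & B] by apply/pred0P => x; rewrite /= !inE; case: (x \in B); rewrite ?andbF.
Qed.

Lemma complU W B : B \subset W -> W :\: B :|: B = W.
Proof.
move=> BW; apply/setP => x; rewrite !inE.
by case: (boolP (x \in B)) => [/(subsetP BW)->|_] //; rewrite orbF.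
Qed.

Lemma cell_cardU i A B : (A, B) \in cells i -> #|A :|: B| = (#|A| + #|B|)%N.
Proof.
rewrite inE => /and3P[_ /= dAB _]; rewrite cardsU.
by have /eqP -> : A :&: B == set0; rewrite ?setI_eq0 // cards0 subn0.
Qed.

Lemma cell_diff i A B : (A, B) \in cells i -> (A :|: B) :\: B = A.
Proof.
rewrite inE => /and3P[_ /= dAB _]; apply/setP => x; rewrite !inE.
by case: (boolP (x \in A)) => [/(disjointFr dAB)->|] //=; case: (x \in B).
Qed.

Lemma subD1_face B b : B \in D -> B :\ b \in D.
Proof. by apply: closedD; apply: subsetDl. Qed.

Lemma kdiff0_eq0 (c : {set 'I_n} -> {set 'I_n} -> k) A B :
  (forall b, b \in B -> b \notin A -> c (b |: A) (B :\ b) = 0) -> kdiff0 c A B = 0.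
Proof.
move=> c0; rewrite /kdiff0 big1 ?oppr0 // => b bB.
by case: ifPn => // bA; rewrite c0 ?mulr0.
Qed.

Lemma eq_kdiff0 (c f : {set 'I_n} -> {set 'I_n} -> k) A B :
  (forall A B, c A B = f A B) -> kdiff0 c A B = kdiff0 f A B.
Proof. by move=> ecf; congr (- _); apply: eq_bigr => b _; rewrite ecf. Qed.

Lemma kdiff0_delta W i m (c : {set 'I_n} -> {set 'I_n} -> k) (z : {set 'I_n} -> k) B :
  #|W| = (i + m)%N -> B \subset W -> #|B| = m.+1 ->
  (forall C, C \subset W -> #|C| = m -> twist W C * c (W :\: C) C = z C) ->
  delta z B = - (twist W B * kdiff0 c (W :\: B) B).
Proof.
move=> cW BW cB ecz; rewrite -delta_twist //; apply: eq_delta => b bB.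
rewrite ecz //; first by apply: subset_trans BW; apply: subsetDl.
by apply/eqP; rewrite -eqSS -cB (cardsD1 b B) bB.
Qed.

(** A relative cocycle on [W] is placed, with twisted signs, on the cells [(W :\: B, B)] of
    multidegree [W]; a preimage under the tensored differential untwists to a primitive. *)
Lemma tor_degree_vanishes_acyclic i m :
  tor_degree_vanishes koszul_resolution i (i + m)%:Z ->
  forall W, #|W| = (i + m)%N -> relatively_acyclic W m.
Proof.
move=> tor W cW c cD dc.
pose f A B := if ((A, B) \in cells i) && (A :|: B == W) then twist W B * c B else 0.
have ef C : C \subset W -> #|C| = m -> twist W C * f (W :\: C) C = c C.
  move=> CW cC; rewrite /f (cells_compl cW CW cC) complU // eqxx andbT.
  case: ifPn => [_|]; first by rewrite mulrA twist_sqr mul1r.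
  by rewrite negbK => /cD ->; rewrite mulr0.
pose v : 'rV[k]_#|cells i| := row_of_fun D i f.
have fv A B : fun_of_row v A B = f A B.
  by apply: row_of_funK => {}A {}B /negPf nAB; rewrite /f nAB.
have fW A B : A :|: B != W -> f A B = 0.
  by rewrite /f => /negPf ->; rewrite andbF.
have hv : @gfr_tensor_homog _ _ _ koszul_resolution i (i + m)%:Z v.
  move=> j; rewrite mxE /f; case: ifP => [/andP[_ /eqP eW] _|]; last by rewrite eqxx.
  by rewrite /= /cell_deg -cW -eW (@cell_cardU i) // -surjective_pairing enum_valP.
have cv : @gfr_tensor_cycle _ _ _ koszul_resolution i v.
  clear tor hv; clearbody v; clearbody f; case: i cW f ef v fv fW => // i cW f ef v fv fW /=.
  rewrite /gfr_tensor_diff /= kmatrix_tensor; apply/rowP => l; rewrite !mxE.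
  move: (enum_valP l); case: (enum_val l) => A B /= AB.
  have [eW|nW] := eqVneq (A :|: B) W; last first.
    apply: kdiff0_eq0 => b bB bA; rewrite fv fW //.
    by rewrite setUAC setD1K // setUC.
  have cB : #|B| = m.+1.
    have := cell_cardU AB; move: AB; rewrite eW cW inE => /and3P[/eqP /= -> _ _].
    by rewrite addSnnS => /addnI.
  have BW : B \subset W by rewrite -eW subsetUr.
  have := kdiff0_delta cW BW cB ef; rewrite dc // -eW (cell_diff AB) => /esym/eqP.
  rewrite oppr_eq0 => /eqP/(congr1 (fun x => twist (A :|: B) B * x)).
  rewrite mulrA twist_sqr mul1r mulr0 => <-.
  exact: eq_kdiff0.
have [w _ ew] := tor v hv cv.
exists (fun B => - (twist W B * fun_of_row w (W :\: B) B)).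
split=> [B BD|B BW cB].
  by rewrite fun_of_row_out ?mulr0 ?oppr0 // inE /= BD !andbF.
have -> : delta (fun B => - (twist W B * fun_of_row w (W :\: B) B)) B =
    twist W B * kdiff0 (fun_of_row w) (W :\: B) B.
  rewrite -[RHS]opprK -delta_twist // /delta -sumrN.
  by apply: eq_bigr => b _; rewrite mulrN.
have [BD|BD] := boolP (B \in D).
  rewrite cD // kdiff0_eq0 ?mulr0 // => b bB _.
  by rewrite fun_of_row_out // inE /= subD1_face ?andbF.
have AB : (W :\: B, B) \in cells i by rewrite (cells_compl cW).
rewrite -[c B]ef // -fv; congr (_ * _).
move: ew; rewrite /gfr_tensor_diff /= kmatrix_tensor => ->.
by rewrite row_of_fun_cell.
Qed.

(** A cycle of degree [i + m] splits into its components in the multidegrees [W] with [i + m]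
    elements, each of which is a relative cocycle. *)
Lemma acyclic_tor_degree_vanishes i m :
  (forall W, #|W| = (i + m)%N -> relatively_acyclic W m) ->
  tor_degree_vanishes koszul_resolution i (i + m)%:Z.
Proof.
move=> acyc v vd vc; pose f := fun_of_row v.
pose z W C := twist W C * f (W :\: C) C.
have zD W B : B \in D -> z W B = 0.
  by move=> BD; rewrite /z /f fun_of_row_out ?mulr0 // inE /= BD !andbF.
have dz W B : #|W| = (i + m)%N -> B \subset W -> #|B| = m.+1 -> delta (z W) B = 0.
  move=> cW BW cB; have [BD|BD] := boolP (B \in D).
    by apply: delta_eq0 => b _; rewrite zD ?subD1_face.
  rewrite (@kdiff0_delta W i m f) //.
  clear acyc vd z zD; rewrite {}/f; case: i v vc cW => [|i] v vc cW.
    by move: (subset_leq_card BW); rewrite cW cB ltnn.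
  have AB : (W :\: B, B) \in cells i.
    by rewrite (@cells_compl i m.+1) // cW addSnnS.
  rewrite -(row_of_fun_cell (kdiff0 (fun_of_row v)) AB) -kmatrix_tensor.
  move: vc; rewrite /= /gfr_tensor_diff /= => ->.
  by rewrite /fun_of_row big1 ?mulr0 ?oppr0 // => j _; rewrite mxE if_same.
have /fin_all_exists[w hw] : forall W, exists w : {set 'I_n} -> k, #|W| = (i + m)%N ->
    (forall B, B \in D -> w B = 0) /\
    (forall B, B \subset W -> #|B| = m -> delta w B = z W B).
  move=> W; have [cW|nW] := eqVneq #|W| (i + m)%N; last first.
    by exists (fun _ => 0) => cW; rewrite cW eqxx in nW.
  have [w hw] := acyc W cW (z W) (@zD W) (fun B => @dz W B cW).
  by exists w.
(* The cell [(A, B)] belongs to multidegree [A :|: B], so the primitives chosen for different [W]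
   occupy disjoint sets of cells. *)
pose u A B := if ((A, B) \in cells i.+1) && (#|A :|: B| == i + m)%N
  then - (twist (A :|: B) B * w (A :|: B) B) else 0.
exists (row_of_fun D i.+1 u).
  move=> j; rewrite mxE /u; case: ifP => [/andP[AB /eqP <-] _|]; last by rewrite eqxx.
  by rewrite /= /cell_deg (cell_cardU AB).
rewrite /gfr_tensor_diff /= kmatrix_tensor; have su A B : fun_of_row (row_of_fun D i.+1 u) A B = u A B.
  by apply: row_of_funK => {}A {}B /negPf nAB; rewrite /u nAB.
apply/rowP => j; rewrite mxE (eq_kdiff0 _ _ su).
have /= := vd j; have := enum_valP j.
rewrite -fun_of_row_enum -/f /cell_deg; case: (enum_val j) => A B /= AB fd.
have [eW|nW] := eqVneq #|A :|: B| (i + m)%N; last first.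
  have [->|/fd fAB] := eqVneq (f A B) 0.
    rewrite kdiff0_eq0 // => b bB bA; rewrite /u.
    have -> : b |: A :|: B :\ b = A :|: B by rewrite setUAC setD1K // setUC.
    by rewrite (negPf nW) andbF.
  by move: nW; rewrite (cell_cardU AB); case: fAB => ->; rewrite eqxx.
pose W := A :|: B; have BW : B \subset W by apply: subsetUr.
have [wD dw] := hw W eW.
have cB : #|B| = m.
  have := cell_cardU AB; move: AB; rewrite eW inE => /and3P[/eqP /= -> _ _].
  by move/addnI.
have BD : B \notin D by move: AB; rewrite inE => /and3P[].
have := dw B BW cB; rewrite /z (cell_diff AB).
move=> /(congr1 (fun x => twist W B * x)); rewrite mulrA twist_sqr mul1r => <-.
have -> : delta (w W) B = twist W B * kdiff0 u (W :\: B) B.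
  rewrite -[RHS]opprK -delta_twist // /delta -sumrN; apply: eq_bigr => b bB.
  rewrite -mulrN; congr (_ * _); rewrite /u complU; last first.
    by apply: subset_trans BW; apply: subsetDl.
  rewrite eW eqxx andbT; case: ifPn => [_|].
    by rewrite mulrN mulrA twist_sqr mul1r opprK.
  have cBb : #|B :\ b|.+1 = m by rewrite -cB (cardsD1 b B) bB.
  rewrite (@cells_compl _ #|B :\ b|) ?negbK; first by move=> /wD ->; rewrite mulr0 oppr0.
  - by rewrite addSnnS cBb.
  - by apply: subset_trans BW; apply: subsetDl.
  - by [].
by rewrite mulrA twist_sqr mul1r (cell_diff AB).
Qed.

End Hochster.

(** * Minimal cycles and cocycles *)

Section LinkConnectivity.

Variables (T : finType) (e : rel T).
Hypotheses (e_sym : ssrbool.symmetric e) (e_irr : irreflexive e).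

Lemma last_take_nth (x : T) p i : (i <= size p)%N -> last x (take i p) = nth x (x :: p) i.
Proof.
move=> ip; rewrite (last_nth x) size_takel //.
by rewrite -[x :: take i p]/(take i.+1 (x :: p)) nth_take.
Qed.

Lemma path_take_drop (x : T) p i : path e x p -> (i <= size p)%N ->
  path e x (take i p) && path e (nth x (x :: p) i) (drop i p).
Proof.
by move=> + ip; rewrite -{1}(cat_take_drop i p) cat_path last_take_nth.
Qed.

Variables (W : {set T}) (v : T).
Hypothesis vW : v \in W.
Hypothesis no_cycle : forall c, minimal_cycle e c -> ~ {subset c <= W}.

(** Otherwise [v :: a :: p] would be a chordless cycle of length at least 4 inside [W]. The
    alternatives are a chord from [v] and a chord of the path. *)
Lemma chordless_fan a p :
  path e a p -> uniq (a :: p) -> {subset a :: p <= W :\ v} ->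
  e v a -> e v (last a p) -> (1 < size p)%N ->
  [\/ exists i, [/\ (0 < i)%N, (i < size p)%N & e v (nth a (a :: p) i)] |
      exists i j, [/\ (i.+1 < j)%N, (j <= size p)%N &
                      e (nth a (a :: p) i) (nth a (a :: p) j)]].
Proof.
move=> pth u sub eva evl sp.
have [i /andP[i0 evi]|nospoke] :=
    pickP (fun i : 'I_(size p) => (0 < i)%N && e v (nth a (a :: p) i)).
  by left; exists i.
have [[i j] /= /andP[ij eij]|nochord] :=
    pickP (fun ij : 'I_(size p).+1 * 'I_(size p).+1 =>
      (ij.1.+1 < ij.2)%N && e (nth a (a :: p) ij.1) (nth a (a :: p) ij.2)).
  by right; exists i, j; split; rewrite // -ltnS.
pose c := v :: a :: p.
have vp : v \notin a :: p by apply/negP => /sub; rewrite !inE eqxx.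
have uc : uniq c by rewrite /= vp.
(* The default value [v] matters: past the end of [a :: p] it is the successor of the last vertex of
   the cycle. *)
have next_c i : (i < size c)%N -> next c (nth v c i) = nth v (a :: p) i.
  by move=> ic; rewrite next_nth mem_nth // index_uniq.
have no_chord i j : (i < j)%N -> (j < size c)%N -> e (nth v c i) (nth v c j) ->
    nth v c j != next c (nth v c i) -> nth v c i != next c (nth v c j) -> False.
  move=> ij jc; have ic := ltn_trans ij jc; rewrite !next_c //.
  case: j ij jc => // j ij jc; case: i ij ic => [|i] ij ic /= eij nj ni.
    case: j jc nj ni eij {ij} => [|j] jc; first by rewrite /= eqxx.
    move=> _ ni eij; have jp : (j.+1 < size p)%N.
      rewrite ltn_neqAle; move: jc; rewrite /= !ltnS => ->; rewrite andbT.
      by apply: contraNneq ni => ej; rewrite /= nth_default // -ej.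
    have := nospoke (Ordinal jp); rewrite /= => /negP; apply.
    by move: eij; rewrite /= (set_nth_default a) // ltnW.
  have ltij : (i.+1 < j)%N.
    rewrite ltn_neqAle [(_ < j)%N]ij andbT; apply: contraNneq nj => <-.
    by [].
  have ip : (i < (size p).+1)%N by exact: ic.
  have jp : (j < (size p).+1)%N by exact: jc.
  have := nochord (Ordinal ip, Ordinal jp); rewrite /= ltij /= => /negP; apply.
  by move: eij; rewrite /= !(set_nth_default a v).
case: (no_cycle (c := c)); last by move=> x; rewrite inE => /predU1P[->|/sub] //; case/setD1P.
split; [split | by [] |]; first exact: ltnW.
  by rewrite /ucycle uc andbT /= eva rcons_path pth /= e_sym.
move=> [x [y [/(nthP v)[i ic <-] /(nthP v)[j jc <-] eij nj ni]]].
have [ij|ji|eij'] := ltngtP i j; first exact: (no_chord i j).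
  by apply: (no_chord j i) => //; rewrite e_sym.
by rewrite eij' e_irr in eij.
Qed.

Variables (R : Type) (g : T -> R).
Hypothesis g_edge : forall a b, a \in W -> b \in W -> e v a -> e v b -> e a b -> g a = g b.

(** Induction on the length of a simple walk: a chord from [v] cuts it into two shorter walks, a
    chord of the path gives a shortcut, and a single edge is covered by [g_edge]. *)
Lemma link_walk a p :
  path e a p -> {subset a :: p <= W :\ v} -> e v a -> e v (last a p) ->
  g a = g (last a p).
Proof.
have [l] := ubnP (size p); elim: l => // l IHl in a p *; rewrite ltnS => sp pth sub eva.
case/shortenP: pth (sub) => q pth u qp {}sub' evl.
have sq : (size q <= size p)%N by apply: uniq_leq_size => //; case/andP: u.
have {}sub : {subset a :: q <= W :\ v}.
  by move=> x; rewrite inE => /predU1P[->|/qp xp]; apply: sub'; rewrite inE ?eqxx // xp orbT.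
have subW x : x \in a :: q -> x \in W by move/sub/setD1P=> [].
case: q => [|b [|b' q]] // in pth u evl sq sub subW qp *.
  apply: g_edge => //; first by apply: subW; rewrite inE eqxx.
    by apply: subW; rewrite !inE eqxx orbT.
  by case/andP: pth.
set q' := b :: b' :: q in pth u evl sq sub subW *.
have [[i [i0 iq evi]]|[i [j [ij jq eij]]]] := chordless_fan pth u sub eva evl isT.
  have /andP[pth1 pth2] := path_take_drop pth (ltnW iq).
  have e1 : g a = g (nth a (a :: q') i).
    rewrite -last_take_nth ?(ltnW iq) //; apply: IHl => //.
    - by rewrite size_takel ?(ltnW iq) // (leq_trans iq) // (leq_trans sq).
    - move=> x; rewrite inE => /predU1P[->|/mem_take xq].
        by apply: sub; rewrite inE eqxx.
      by apply: sub; rewrite inE xq orbT.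
    - by rewrite last_take_nth ?(ltnW iq).
  rewrite e1 -{2}(cat_take_drop i q') last_cat last_take_nth ?(ltnW iq) //.
  apply: IHl => //.
  - rewrite size_drop; apply: leq_trans (leq_trans sq sp).
    by rewrite ltn_subrL i0.
  - move=> x; rewrite inE => /predU1P[->|/mem_drop xq].
      by apply/sub/mem_nth; rewrite /= ltnS ltnW.
    by apply: sub; rewrite inE xq orbT.
  - by rewrite -last_take_nth ?(ltnW iq) // -last_cat cat_take_drop.
have j0 : (0 < j)%N by apply: leq_ltn_trans ij.
have jq' : (j.-1 < size q')%N by rewrite prednK.
have iq : (i <= size q')%N by apply: ltnW; apply: leq_trans jq; apply: ltnW.
have /andP[pth1 _] := path_take_drop pth iq.
have /andP[_ pth2] := path_take_drop pth jq.
(* Vertex [j] of [a :: q'] has index [j.-1] in [q'], so [r] follows the walk to vertex [i] and then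
   jumps along the chord. *)
pose r := take i q' ++ drop j.-1 q'.
have er : drop j.-1 q' = nth a (a :: q') j :: drop j q'.
  by rewrite (drop_nth a) //; case: (j) j0.
have elast : last a r = last a q'.
  by rewrite /r er last_cat [LHS]/= -[in RHS](cat_take_drop j q') last_cat last_take_nth.
rewrite -elast; apply: IHl => //.
- rewrite size_cat size_takel // size_drop; apply: leq_trans (leq_trans sq sp).
  by rewrite addnBA ?(ltnW jq') // ltn_subLR ?ltn_add2r //; lia.
- by rewrite cat_path pth1 er /= last_take_nth // eij.
- move=> x; rewrite inE mem_cat => /predU1P[->|/orP[/mem_take|/mem_drop] xq].
  + by apply: sub; rewrite inE eqxx.
  + by apply: sub; rewrite inE xq orbT.
  + by apply: sub; rewrite inE xq orbT.
- by rewrite elast.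
Qed.

End LinkConnectivity.

(** * Cochains of flag complexes *)

Section FlagCochains.

Variables (R : comNzRingType) (n : nat) (D : {set {set 'I_n}}).
Hypothesis closedD : forall A B : {set 'I_n}, A \subset B -> B \in D -> A \in D.
Implicit Types (a b u v : 'I_n) (B C W : {set 'I_n}) (y z : {set 'I_n} -> R).

Local Notation e := (one_skeleton D).

Lemma edge_sym : ssrbool.symmetric e.
Proof. by move=> a b; rewrite /one_skeleton eq_sym setUC. Qed.

Lemma edge_irr : irreflexive e.
Proof. by move=> a; rewrite /one_skeleton eqxx. Qed.

Lemma face_edge B a b : B \in D -> a \in B -> b \in B -> a != b -> e a b.
Proof.
move=> BD aB bB ab; rewrite /one_skeleton ab; apply: closedD BD.
by apply/subsetP => x; rewrite !inE => /orP[] /eqP ->.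
Qed.

Lemma delta_pair a b y : a != b ->
  delta y [set a; b] = inv_sgn R a b * (y [set b] - y [set a]).
Proof.
move=> ab; have ba : b != a by rewrite eq_sym.
have s0 x : sgn R x set0 = 1.
  by rewrite /sgn (_ : [set _ in _ | _] = set0) ?cards0 //; apply/setP => i; rewrite !inE.
have s1 (x x' : 'I_n) : sgn R x [set x'] = inv_sgn R x x'.
  by rewrite -[[set x']]setU0 sgnU1 ?inE // s0 mulr1.
rewrite /delta big_setU1 ?inE //= big_set1 setU1K ?inE // [[set a; b]]setUC.
rewrite setU1K ?inE // sgn_self ?inE // s1 [b |: _]setUC sgn_self ?inE // s1.
by rewrite (inv_sgnC _ ba) mulNr mulrBr.
Qed.

Hypothesis flagD : forall B, B \notin D ->
  exists a b, [/\ a \in B, b \in B, a != b & [set a; b] \notin D].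

(** A non-face would contain a non-edge, but all edges inside [B] and from [v] to [B] are present.
    Hence the link of [v] is induced on its neighbours. *)
Lemma cone_face B v : B \in D -> (forall u, u \in B -> e v u) -> v |: B \in D.
Proof.
move=> BD vB; apply/negPn/negP => /flagD[a [b [aB bB ab]]] /negP; apply.
move: aB bB ab; rewrite !inE => /predU1P[->|aB] /predU1P[->|bB] ab.
- by rewrite eqxx in ab.
- by case/andP: (vB b bB).
- by rewrite setUC; case/andP: (vB a aB).
- by case/andP: (face_edge BD aB bB ab).
Qed.

Section Induction.

Variables (W : {set 'I_n}) (v : 'I_n) (t : nat) (z : {set 'I_n} -> R).
Hypothesis vW : v \in W.
Hypothesis z_off_v : forall B, B \subset W :\ v -> B \in D -> #|B| = t -> z B = 0.
Hypothesis dz : forall B, B \subset W -> B \in D -> #|B| = t.+1 -> delta z B = 0.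

Definition link : {set 'I_n} := [set u in W | e v u].

Lemma link_subset : link \subset W :\ v.
Proof.
by apply/subsetP => u; rewrite !inE => /andP[-> /andP[vu _]]; rewrite eq_sym vu.
Qed.

(** As [z] vanishes off [v], the cone homotopy turns the cocycle condition on [v |: B] into one for
    [cone v z] on the link. *)
Lemma delta_cone_link B : B \subset link -> B \in D -> #|B| = t ->
  delta (cone v z) B = 0.
Proof.
move=> BN BD cB; have BW := subset_trans BN link_subset.
have vB : v \notin B by apply/negP => /(subsetP BW); rewrite !inE eqxx.
have := cone_homotopy v z B; rewrite z_off_v // => /eqP; rewrite addr_eq0 => /eqP ->.
rewrite /cone (negPf vB) dz ?mulr0 ?oppr0 //.
- by rewrite subUset sub1set vW; apply: subset_trans BW (subsetDl _ _).
- by apply: cone_face => // u /(subsetP BN); rewrite inE => /andP[].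
- by rewrite cardsU1 vB cB.
Qed.

(** The cone homotopy at [B :\ v] converts the link condition into [delta y B = z B] for faces
    through [v]; on the other faces both sides vanish. *)
Lemma star_extension y : (1 < t)%N ->
  (forall B, B \subset W :\ v -> B \in D -> #|B| = t -> delta y B = 0) ->
  (forall C, C \subset link -> C \in D -> #|C|.+1 = t ->
     delta (cone v y) C = y C - cone v z C) ->
  forall B, B \subset W -> B \in D -> #|B| = t -> delta y B = z B.
Proof.
move=> t1 y0 ylink B BW BD cB; have [vB|vB] := boolP (v \in B); last first.
  have BWv : B \subset W :\ v.
    apply/subsetP => x xB; rewrite !inE (subsetP BW _ xB) andbT.
    by apply: contraNneq vB => <-.
  by rewrite y0 // z_off_v.
have Bv : v \notin B :\ v by rewrite !inE eqxx.
have := cone_homotopy v y (B :\ v); rewrite ylink.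
- rewrite -addrA -[RHS]addr0 => /addrI/eqP; rewrite addrC subr_eq0.
  rewrite /cone (negPf Bv) setD1K // => /eqP/(congr1 (fun x => sgn R v (B :\ v) * x)).
  by rewrite !mulrA sgn_sqr !mul1r.
- apply/subsetP => u; rewrite !inE => /andP[uv uB]; rewrite (subsetP BW) //=.
  by apply: face_edge BD _ _ _ => //; rewrite eq_sym.
- by apply: closedD BD; apply: subsetDl.
- by rewrite -cB (cardsD1 v B) vB.
Qed.

End Induction.

(** Having fewer than [p + 3] vertices, [W] contains no minimal cycle. By [link_walk] the cocycle
    then takes one value on all neighbours of [v] in the same component of [W :\ v], so it extends
    to that component. *)
Lemma link_potential (p : nat) W v z : v \in W -> (#|W| < p + 3)%N ->
  (forall c, minimal_cycle e c -> (p + 3 <= size c)%N) ->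
  (forall B, B \subset W :\ v -> B \in D -> #|B| = 2%N -> z B = 0) ->
  (forall B, B \subset W -> B \in D -> #|B| = 3%N -> delta z B = 0) ->
  exists f : 'I_n -> R, [/\ f v = 0,
    forall a b, a \in W :\ v -> b \in W :\ v -> e a b -> f a = f b &
    forall u, u \in link W v -> f u = cone v z [set u]].
Proof.
move=> vW cW hmin z0 dz; pose N := link W v.
pose e' := [rel x y | [&& x \in W :\ v, y \in W :\ v & e x y]].
have e'_sym : ssrbool.symmetric e'.
  by move=> x y /=; rewrite edge_sym andbCA.
(* A component without neighbours of [v] gets the value 0. *)
exists (fun u => if u == v then 0 else
  if [pick a in N | connect e' a u] is Some a then cone v z [set a] else 0).
split; first by rewrite eqxx.
  move=> a b; rewrite !inE => /andP[av aW] /andP[bv bW] ab.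
  rewrite (negPf av) (negPf bv); congr (if _ is Some _ then _ else _).
  apply: eq_pick => x; congr (_ && _); apply: same_connect_r.
    exact: sym_connect_sym.
  by apply: connect1; rewrite /= !inE av aW bv bW.
move=> u uN; have := subsetP (link_subset W v) _ uN.
rewrite inE in_set1 => /andP[uv uW]; rewrite (negPf uv).
case: pickP => [a /andP[aN /connectP[q pth eu]]|/(_ u)]; last first.
  by rewrite /= [u \in N]uN connect0.
rewrite eu; apply: (@link_walk _ e edge_sym edge_irr W v vW _ R (fun u => cone v z [set u])).
- move=> c hc cW'; have := hmin c hc; rewrite leqNgt => /negP; apply.
  apply: leq_ltn_trans cW; have /andP[_ uc] : ucycle e c by case: hc => [[]].
  by rewrite -(card_uniqP uc); apply/subset_leq_card/subsetP.
- move=> b c bW cW' vb vc bc; have bcne : b != c by case/andP: bc.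
  have bcD : [set b; c] \in D by case/andP: bc.
  have := @delta_cone_link W v 2 z vW z0 dz [set b; c] _ bcD; rewrite cards2 bcne.
  rewrite delta_pair // subUset !sub1set !inE bW cW' vb vc => /(_ isT erefl).
  move=> /(congr1 (fun x => inv_sgn R b c * x)); rewrite mulrA inv_sgn_sqr mul1r mulr0.
  by move/eqP; rewrite subr_eq0 => /eqP.
- by move: pth; apply: sub_path => ? ? /and3P[].
- have aW : a \in W :\ v by apply: (subsetP (link_subset W v)).
  move=> x; rewrite in_cons => /predU1P[->//|].
  elim: q a pth {eu aN} aW x => //= b q IHq a /andP[/and3P[_ bW _] pth] _ x.
  by rewrite in_cons => /predU1P[->//|]; apply: (IHq b pth bW).
- by move: aN; rewrite inE => /andP[].
- by rewrite -eu; move: uN; rewrite inE => /andP[].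
Qed.

(** Induction on [#|W|]: after solving on [W :\ v], the correction on faces through [v] is a problem
    on the link with [t - 1]. The bound [p + t] survives because the link omits [v], and for [t = 2]
    it reads [#|W| < p + 3]. *)
Lemma face_cochain_exact (p : nat) W t z : (1 < t)%N -> (#|W| <= p + t)%N ->
  (forall c, minimal_cycle e c -> (p + 3 <= size c)%N) ->
  (forall B, B \subset W -> B \in D -> #|B| = t.+1 -> delta z B = 0) ->
  exists y, forall B, B \subset W -> B \in D -> #|B| = t -> delta y B = z B.
Proof.
move=> + + hmin; have [l] := ubnP #|W|; elim: l => // l IHl in W t z *.
rewrite ltnS => cWl t1 cW dz.
have [W0|[v vW]] := set_0Vmem W.
  exists (fun _ => 0) => B; rewrite W0 subset0 => /eqP -> _.
  by rewrite cards0 => t0; rewrite -t0 in t1.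
have cWv : #|W| = #|W :\ v|.+1 by rewrite (cardsD1 v W) vW.
have [y1 hy1] : exists y, forall B, B \subset W :\ v -> B \in D -> #|B| = t ->
    delta y B = z B.
  apply: IHl => //; first by rewrite -cWv.
    by apply: leq_trans cW; rewrite cWv.
  by move=> B BW; apply: dz; apply: subset_trans BW (subsetDl _ _).
pose z1 C := z C - delta y1 C.
have z1_off B : B \subset W :\ v -> B \in D -> #|B| = t -> z1 B = 0.
  by move=> BW BD cB; rewrite /z1 hy1 ?subrr.
have dz1 B : B \subset W -> B \in D -> #|B| = t.+1 -> delta z1 B = 0.
  by move=> BW BD cB; rewrite deltaB dz // delta_delta subrr.
suff [y2 hy2] : exists y, forall B, B \subset W -> B \in D -> #|B| = t ->
    delta y B = z1 B.
  exists (fun C => y1 C + y2 C) => B BW BD cB.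
  by rewrite deltaD hy2 // /z1 addrC subrK.
have [t2|t3] := eqVneq t 2%N.
  have [f [fv fe fN]] : exists f : 'I_n -> R, [/\ f v = 0,
      forall a b, a \in W :\ v -> b \in W :\ v -> e a b -> f a = f b &
      forall u, u \in link W v -> f u = cone v z1 [set u]].
    apply: (@link_potential p) => //; first by rewrite addn3 ltnS -addn2 -t2.
      by move=> B BW BD cB; apply: z1_off; rewrite ?t2.
    by move=> B BW BD cB; apply: dz1; rewrite ?t2.
  (* On singletons this sum is [f], and [f v = 0] makes its cone vanish on the empty set, as
     [star_extension] requires. *)
  exists (fun C => \sum_(u in C) f u); apply: (star_extension z1_off) => //.
    move=> B BW BD; rewrite t2 => /eqP/cards2P[a [b [ab eB]]].
    have eab : e a b by apply: face_edge BD _ _ _; rewrite ?eB ?inE ?eqxx ?orbT.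
    rewrite eB delta_pair // !big_set1 (fe a b) ?subrr ?mulr0 //;
      by apply: (subsetP BW); rewrite eB !inE eqxx ?orbT.
  rewrite t2 => C CN _ [] /eqP/cards1P[u eC].
  have uN : u \in link W v by apply: (subsetP CN); rewrite eC inE.
  rewrite eC big_set1 fN // subrr; apply: delta_eq0 => b; rewrite inE => /eqP ->.
  by rewrite setDv /cone inE setU0 big_set1 fv mulr0.
have [y hy] : exists y, forall B, B \subset link W v -> B \in D -> #|B| = t.-1 ->
    delta y B = cone v z1 B.
  have ltN : (#|link W v| < #|W|)%N by rewrite cWv ltnS subset_leq_card ?link_subset.
  apply: IHl; [exact: leq_trans cWl | by lia | by lia |].
  move=> B BN BD cB; apply: (delta_cone_link vW z1_off dz1) => //.
  by rewrite cB prednK // ltnW.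
(* Chosen so that its cone at [v] is [- y] on the link while it vanishes off [v]. *)
exists (fun C => if v \in C then - (sgn R v (C :\ v) * y (C :\ v)) else 0).
apply: (star_extension z1_off) => //.
  move=> B BW _ _; apply: delta_eq0 => b _.
  have vB : v \notin B by apply/negP => /(subsetP BW); rewrite !inE eqxx.
  by rewrite inE (negPf vB) andbF.
move=> C CN CD cC.
have vC : v \notin C.
  by apply/negP => /(subsetP (subset_trans CN (link_subset W v))); rewrite !inE eqxx.
rewrite (negPf vC) sub0r -hy //; last by rewrite -cC.
rewrite /delta -sumrN; apply: eq_bigr => b bC; rewrite /cone.
have vCb : v \notin C :\ b by rewrite inE (negPf vC) andbF.
by rewrite (negPf vCb) setU11 setU1K // mulrN mulrA sgn_sqr mul1r mulrN.
Qed.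

End FlagCochains.

(** * Squarefree monomials in ideals, and flagness from quadratic generation *)

Section SquarefreeMembership.

Variables (k : fieldType) (n : nat).

Lemma sqfree_ideal_monomial (E : {set {set 'I_n}}) (A : {set 'I_n}) :
  A \in E -> sqfree_ideal E (sqfree_monomial k A).
Proof.
move=> AE; exists (fun B => (B == A)%:R); rewrite (bigD1 A) //= eqxx mul1r.
by rewrite big1 ?addr0 // => B /andP[_ /negPf ->]; rewrite mul0r.
Qed.

(** In any expression of [x^B] through the generators, some term contains the monomial [x^B], and
    its generator divides it. *)
Lemma sqfree_ideal_monomial_dvd (E : {set {set 'I_n}}) (B : {set 'I_n}) :
  sqfree_ideal E (sqfree_monomial k B) -> exists2 A, A \in E & A \subset B.
Proof.
move=> [c /mpolyP/(_ (indm B))]; rewrite sqfree_monomialE mcoeffX eqxx => /eqP.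
have [A /andP[AE AB] _|noA] := pickP (fun A => (A \in E) && (A \subset B)).
  by exists A.
rewrite (raddf_sum (mcoeff _)) big1 ?oner_eq0 //= => A AE.
rewrite sqfree_monomialE mulrC mcoeffXM; case: ifP => // /mnm_lepP le.
have /negP[] := negbT (noA A); rewrite AE; apply/subsetP => a aA.
by move: (le a); rewrite !mnmE aA; case: (a \in B).
Qed.

(** Some quadratic generator divides [x^B]. It lies in the Stanley-Reisner ideal, so its two
    variables contain a non-face and thus form one. *)
Lemma quadratic_flag (D : {set {set 'I_n}}) :
  (forall A B : {set 'I_n}, A \subset B -> B \in D -> A \in D) ->
  generated_by_sqfree_quadrics (stanley_reisner (k := k) D) ->
  forall B, B \notin D -> exists a b, [/\ a \in B, b \in B, a != b & [set a; b] \notin D].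
Proof.
move=> closedD [E E2 IE] B BD.
have /IE/sqfree_ideal_monomial_dvd[A AE AB] : stanley_reisner D (sqfree_monomial k B).
  by apply: sqfree_ideal_monomial; rewrite inE.
have /IE/sqfree_ideal_monomial_dvd[C] := sqfree_ideal_monomial AE.
rewrite inE => CD CA; have /eqP/cards2P[a [b [ab eA]]] := E2 A AE.
exists a, b; rewrite -eA; split=> //; try by apply: (subsetP AB); rewrite eA !inE eqxx ?orbT.
by apply: contra CD; apply: closedD.
Qed.

End SquarefreeMembership.

(** * Relative acyclicity and minimal cycles *)

Section CyclesAndAcyclicity.

Variables (k : fieldType) (n : nat) (D : {set {set 'I_n}}).
Hypothesis closedD : forall A B : {set 'I_n}, A \subset B -> B \in D -> A \in D.

Local Notation e := (one_skeleton D).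

(** This is the connecting map: [c] is the coboundary of [cone v c] on [W], and since [c] vanishes
    on faces, [cone v c] is a cocycle of [Delta_W]. It equals some [delta y] there, and subtracting
    [delta y] leaves a primitive that vanishes on faces. *)
Lemma long_cycles_acyclic (p m : nat) (W : {set 'I_n}) :
  (forall B, B \notin D -> exists a b, [/\ a \in B, b \in B, a != b & [set a; b] \notin D]) ->
  (forall c, minimal_cycle e c -> (p + 3 <= size c)%N) ->
  (2 < m)%N -> (#|W| < p + m)%N -> relatively_acyclic k D W m.
Proof.
move=> flagD hmin m2 cW c cD dc.
have [W0|[v vW]] := set_0Vmem W.
  exists (fun _ => 0); split=> // B; rewrite W0 subset0 => /eqP ->.
  by rewrite cards0 => m0; rewrite -m0 in m2.
have dcone (B : {set 'I_n}) : B \subset W -> #|B| = m -> delta (cone v c) B = c B.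
  move=> BW cB; rewrite -[RHS](cone_homotopy v) [X in _ + X](_ : _ = 0) ?addr0 //.
  rewrite /cone; case: ifPn => // vB; rewrite dc ?mulr0 //.
    by rewrite subUset sub1set vW.
  by rewrite cardsU1 vB cB.
have mS : m.-1.+1 = m by rewrite prednK // (leq_ltn_trans _ m2).
have [y hy] := @face_cochain_exact _ _ _ closedD flagD p W m.-1 (cone v c)
  ltac:(lia) ltac:(lia) hmin
  (fun B BW BD cB => etrans (dcone B BW (etrans cB mS)) (cD B BD)).
exists (fun B => if B \in D then 0 else cone v c B - delta y B).
split=> [B ->|B BW cB] //.
rewrite (eq_delta (w := fun C => cone v c C - delta y C)) => [|b bB].
  by rewrite deltaB delta_delta subr0 dcone.
case: ifP => // BbD; rewrite hy ?subrr //; first by apply: subset_trans BW; apply: subsetDl.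
by rewrite -cB (cardsD1 b B) bB.
Qed.

(** A relative primitive would make the indicator of the edge [c0 c1] the coboundary of a vertex
    function on the cycle. That function is constant along all other edges, so going round
    contradicts its jump on [c0 c1]. *)
Lemma minimal_cycle_not_acyclic (c : seq 'I_n) :
  minimal_cycle e c -> ~ relatively_acyclic k D [set x in c] 3.
Proof.
case: c => [|c0 [|c1 [|c2 [|c3 s]]]] [[_ cyc] //= _ nochord] acyc.
set c := [:: c0, c1, c2, c3 & s] in cyc nochord acyc; set W := [set x in c] in acyc.
have /andP[pth uc] := cyc.
have next_c i : (i < size c)%N -> next c (nth c0 c i) = nth c0 (behead c) i.
  by move=> ic; rewrite next_nth mem_nth // index_uniq.
have n0 : next c c0 = c1 := next_c 0 isT.
have n1 : next c c1 = c2 := next_c 1 isT.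
have n2 : next c c2 = c3 := next_c 2 isT.
have inc i : (i < size c)%N -> nth c0 c i \in c by apply: mem_nth.
have inW x : x \in c -> x \in W by move=> xc; rewrite in_set.
have neq i j : (i < size c)%N -> (j < size c)%N -> i != j -> nth c0 c i != nth c0 c j.
  by move=> ic jc; rewrite nth_uniq.
have c01 : c0 != c1 := neq 0 1 isT isT isT.
have c03 : c0 != c3 := neq 0 3 isT isT isT.
(* Without chords [b] must precede [c0] and follow [c1], so [b = c2] and [c0 = c3], impossible with
   at least four vertices. *)
have no_triangle b : b \in c -> b != c1 -> e c0 b -> e c1 b -> False.
  move=> bc b1 e0 e1.
  have n0b : c0 = next c b.
    apply/eqP/negPn/negP => nn; apply: nochord; exists c0, b.
    by split; rewrite ?n0 // (inc 0).
  have b2 : b = c2.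
    apply/eqP/negPn/negP => nn; apply: nochord; exists c1, b.
    by split; rewrite ?n1 ?(inc 1) // -n0b eq_sym.
  by move: c03; rewrite n0b b2 n2 eqxx.
pose z (B : {set 'I_n}) : k := (B == [set c0; c1])%:R.
have dzD (B : {set 'I_n}) : B \subset W -> B \in D -> delta z B = 0.
  move=> BW BD; apply: delta_eq0 => b bB; rewrite /z; case: eqP => // eB.
  have [c0B c1B] : c0 \in B :\ b /\ c1 \in B :\ b by rewrite eB !inE !eqxx orbT.
  case: (@no_triangle b).
  - by have := subsetP BW b bB; rewrite inE.
  - by move: c1B; rewrite !inE eq_sym => /andP[].
  - by move: c0B; rewrite !inE => /andP[b0 c0B]; apply: face_edge BD _ _ _; rewrite // eq_sym.
  - by move: c1B; rewrite !inE => /andP[b0 c1B]; apply: face_edge BD _ _ _; rewrite // eq_sym.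
(* The value 0 on all faces makes [f] a relative cochain; on subsets of [W] it is still
   [delta z]. *)
pose f (B : {set 'I_n}) := if B \in D then 0 else delta z B.
have fE (B : {set 'I_n}) : B \subset W -> f B = delta z B.
  by move=> BW; rewrite /f; case: ifP => // BD; rewrite dzD.
have [||w [wD dw]] := acyc f.
- by move=> B BD; rewrite /f BD.
- move=> B BW _; rewrite (eq_delta (w := delta z)) ?delta_delta // => b _.
  by rewrite fE // (subset_trans _ BW) // subsetDl.
(* On [W] the difference [z - w] is a cocycle, so its cone from [c0] is a primitive, read here as a
   function of vertices. *)
pose y x := cone c0 (fun B => z B - w B) [set x].
have hy a b : a \in c -> b \in c -> e a b ->
    z [set a; b] = inv_sgn k a b * (y b - y a).
  move=> ac bc /andP[ab abD]; rewrite -delta_pair // -[LHS]subr0 -(wD _ abD).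
  have := cone_homotopy c0 (fun B => z B - w B) [set a; b] => /= <-.
  rewrite [X in _ + X](_ : _ = 0) ?addr0 //= /cone; case: ifPn => // c0ab.
  rewrite deltaB dw ?fE ?subrr ?mulr0 //.
  - by rewrite !subUset !sub1set !inW // (inc 0).
  - by rewrite !subUset !sub1set !inW // (inc 0).
  - by rewrite cardsU1 c0ab cards2 ab.
have y_eq a b : a \in c -> b \in c -> e a b -> [set a; b] != [set c0; c1] -> y a = y b.
  move=> ac bc ab /negPf nab; have := hy a b ac bc ab; rewrite /z nab.
  move=> /(congr1 (fun x => inv_sgn k a b * x)); rewrite mulrA inv_sgn_sqr mul1r mulr0.
  by move/esym/eqP; rewrite subr_eq0 => /eqP.
have tailc x : x \in behead c -> x \in c by move=> xc; rewrite in_cons xc orbT.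
have n0c x : x \in behead c -> x != c0.
  by move=> xc; apply: contraTneq xc => ->; case/andP: uc.
have y_walk a q : path e a q -> {subset a :: q <= behead c} -> y a = y (last a q).
  elim: q a => //= b q IHq a /andP[ab pq] sub.
  have suba : a \in behead c by apply: sub; apply: mem_head.
  have subb : b \in behead c by apply: sub; rewrite in_cons mem_head orbT.
  rewrite -IHq // => [|x xq]; last by apply: sub; rewrite in_cons xq orbT.
  apply: y_eq; [exact: tailc | exact: tailc | exact: ab |].
  apply/eqP => /setP/(_ c0); rewrite !in_set2 eqxx /= (eq_sym c0) (negPf (n0c a suba)).
  by rewrite eq_sym (negPf (n0c b subb)).
have : path e c0 (rcons (behead c) c0) by [].
rewrite rcons_path => /andP[/andP[e01 e12] elast].
have lastc : last c1 [:: c2, c3 & s] \in behead c by apply: mem_last.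
have nlast : last c1 [:: c2, c3 & s] != c1.
  have /andP[_ /andP[c1n _]] := uc.
  by apply: contraNneq c1n => <-; rewrite [last _ _]/= in_cons mem_last orbT.
have y1 := y_walk c1 [:: c2, c3 & s] e12 (fun x xc => xc).
have y0 : y (last c1 [:: c2, c3 & s]) = y c0.
  apply: y_eq; [exact: tailc | exact: (inc 0) | exact: elast |].
  apply/eqP => /setP/(_ c1); rewrite !in_set2 eqxx orbT.
  by rewrite [c1 == c0]eq_sym (negPf c01) eq_sym (negPf nlast).
have := hy c0 c1 (inc 0 isT) (inc 1 isT) e01.
by rewrite y1 y0 subrr mulr0 /z eqxx => /eqP; rewrite oner_eq0.
Qed.

End CyclesAndAcyclicity.

(** * Linear syzygies and the length of minimal cycles *)

Theorem theorem2p1 (k : closedFieldType) (r : nat)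
    (D : {set {set 'I_r.+1}}) (p : nat)
    (hD : simplicial_complex D)
    (hI : generated_by_sqfree_quadrics (stanley_reisner (k := k) D))
    (hp : (1 < p)%N) :
  satisfies_N2 (stanley_reisner (k := k) D) p <->
  (forall c : seq 'I_r.+1,
     minimal_cycle (one_skeleton D) c -> (p + 3 <= size c)%N).
Proof.
case: hD => closedD _; split=> [[F torF] c cmin|hmin].
  rewrite leqNgt; apply/negP => short_c.
  have size_c : (3 < size c)%N by case: cmin.
  (* With [m = 3] and [W] the vertex set of the cycle, [i] is [size c - 3]. It is below [p] because
     the cycle is short, and the degree [i + 3] exceeds [i + 2]. *)
  have /tor_degree_vanishes_indep := torF (size c - 3)%N (size c - 3 + 3)%:Z
    ltac:(lia) ltac:(lia).
  move=> /(_ (koszul_resolution k closedD))/tor_degree_vanishes_acyclic acyc.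
  apply: (minimal_cycle_not_acyclic closedD cmin (acyc _ _)).
  have /andP[_ uc] : ucycle (one_skeleton D) c by case: cmin => [[]].
  by rewrite cardsE (card_uniqP uc) subnK // ltnW.
exists (koszul_resolution k closedD) => i d ip id2.
(* A degree above [i + 2] means [m > 2], and [i < p] then gives [#|W| < p + m]. *)
have [m [ed m2]] : exists m : nat, d = (i + m)%:Z /\ (2 < m)%N.
  by exists (`|d| - i)%N; lia.
rewrite ed; apply: acyclic_tor_degree_vanishes => W cW.
apply: (@long_cycles_acyclic _ _ _ closedD p) => //; last by rewrite cW ltn_add2r.
exact: quadratic_flag closedD hI.
Qed.
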